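(* There is no Polish space $Y$ and Borel function $g\colon \mathcal V^\omega(T^2)\to Y$ such that for all $v,w\in\mathcal V^\omega(T^2)$ one has $v\sim w$ if and only if $g(v)=g(w)$. Here $\sim$ denotes orbital topological equivalence. In other words, orbital topological equivalence in $\mathcal V^\omega(T^2)$ has no complete Borel numerical invariant.
   Context: $T^2=\mathbb R^2/\mathbb Z^2$ is the two-torus and $\mathcal V^\omega(T^2)$ is the space of real-analytic vector fields on $T^2$, with its usual topology (the inductive limit, over complex neighborhoods of $T^2$ in $\mathbb C^2/\mathbb Z^2$, of the spaces of vector fields that extend holomorphically and boundedly to the neighborhood, with the sup norm). Two vector fields $v,w$ on $T^2$ are orbitally topologically equivalent, written $v\sim w$, if there exists a homeomorphism $H\colon T^2\to T^2$, homotopic to the identity, that takes orbits of $v$ to orbits of $w$, preserving time orientation. A topological space is Polish if it is separable and completely metrizable. A map between topological spaces is Borel if preimages of open sets are Borel sets. *)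

(* Defs.v *)
From HB Require Import structures.
From mathcomp Require Import all_boot all_order all_algebra.
From mathcomp Require Import generic_quotient complex.
From mathcomp Require Import all_classical all_reals all_analysis.

Set Implicit Arguments.
Unset Strict Implicit.
Unset Printing Implicit Defensive.

Import Order.TTheory GRing.Theory Num.Theory.
Import numFieldNormedType.Exports.

Local Open Scope classical_set_scope.
Local Open Scope ring_scope.
Local Open Scope quotient_scope.

(* K^2/Z^2 with the quotient topology. For K = R it is the two-torus, for
   K = R[i] it is its complexification C^2/Z^2. *)
Section torus.
Variable K : numFieldType.

Definition lattice_eqv (p q : K * K) : bool :=
  `[< exists m n : int, p - q = (m%:~R, n%:~R) >].

Lemma lattice_eqv_refl : reflexive lattice_eqv.
Proof.
by move=> p; apply/asboolT; exists 0, 0; rewrite subrr; exact: erefl.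
Qed.

Lemma lattice_eqv_sym : symmetric lattice_eqv.
Proof.
suff sub p q : lattice_eqv p q -> lattice_eqv q p
  by move=> p q; apply/idP/idP; exact: sub.
move=> /asboolW[m [n pq]]; apply/asboolT; exists (- m), (- n).
by rewrite -opprB pq !mulrNz; exact: erefl.
Qed.

Lemma lattice_eqv_trans : transitive lattice_eqv.
Proof.
move=> q p r /asboolW[m [n pq]] /asboolW[m' [n' qr]]; apply/asboolT.
exists (m + m'), (n + n').
by rewrite -(subrKA q) pq qr !mulrzDr; exact: erefl.
Qed.

Canonical lattice_equiv :=
  EquivRel lattice_eqv lattice_eqv_refl lattice_eqv_sym lattice_eqv_trans.

Definition torus := {eq_quot lattice_equiv}.

HB.instance Definition _ := Topological.copy torus (quotient_topology torus).

Definition torus_pi (p : K * K) : torus := \pi_torus p.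

Definition torus_differentiable (F : torus -> K * K) (p : K * K) : Prop :=
  differentiable (F \o torus_pi) p.

End torus.

Section vector_fields.
Variable R : realType.

Definition complexify (p : R * R) : R[i] * R[i] := (p.1%:C, p.2%:C)%C.

(* The inclusion of R^2/Z^2 into C^2/Z^2. *)
Definition torus_incl (x : torus R) : torus R[i] :=
  torus_pi (complexify (repr x)).

Definition complex_nbhd (W : set (torus R[i])) : Prop :=
  open W /\ range torus_incl `<=` W.

(* Only the values of F on W matter. *)
Definition bounded_holomorphic (W : set (torus R[i]))
    (F : torus R[i] -> R[i] * R[i]) : Prop :=
  (forall z : R[i] * R[i], W (torus_pi z) ->
     torus_differentiable F z) /\
  (exists M : R[i], forall x, W x -> `|F x| <= M).

(* Vector fields on the torus are identified with maps torus R -> R * R through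
   the translation-invariant trivialization of the tangent bundle. *)
Definition extends_field (F : torus R[i] -> R[i] * R[i])
    (v : torus R -> R * R) : Prop :=
  forall x, F (torus_incl x) = complexify (v x).

(* By compactness of the torus, real-analyticity amounts to having a bounded
   holomorphic extension to some complex neighborhood; the set of real-analytic
   fields is thus the union whose inductive limit topology is taken below. *)
Definition real_analytic (v : torus R -> R * R) : Prop :=
  exists W F,
    [/\ complex_nbhd W, bounded_holomorphic W F & extends_field F v].

Record analytic_field := AnalyticField {
  field_fun :> torus R -> R * R;
  field_analytic : real_analytic field_fun }.

HB.instance Definition _ := gen_eqMixin analytic_field.
HB.instance Definition _ := gen_choiceMixin analytic_field.

(* Inductive limit topology: the finest one for which, for each complex
   neighborhood W, the restriction to the torus is continuous on the space of
   bounded holomorphic fields on W (real on the torus) with the sup norm. As the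
   linking maps of this inductive system are compact (Montel), the locally convex
   inductive limit has the same topology. *)
Definition analytic_open (U : set analytic_field) : Prop :=
  forall W, complex_nbhd W ->
  forall F (v : analytic_field), bounded_holomorphic W F -> extends_field F v ->
  U v ->
  exists2 e : R, 0 < e &
    forall G (w : analytic_field), bounded_holomorphic W G ->
      extends_field G w ->
      (forall x, W x -> `|F x - G x| < (e%:C)%C) -> U w.

Lemma analytic_openT : analytic_open setT.
Proof. by move=> W _ F v _ _ _; exists 1. Qed.

Lemma analytic_openI : setI_closed analytic_open.
Proof.
move=> A B oA oB W nW F v bF Fv [Av Bv].
have [a a0 Aa] := oA W nW F v bF Fv Av.
have [b b0 Bb] := oB W nW F v bF Fv Bv.
exists (Num.min a b); first by rewrite lt_min a0.
move=> G w bG Gw FG; split.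
- apply: (Aa G w bG Gw) => x Wx; apply: lt_le_trans (FG x Wx) _.
  by rewrite lecR ge_min lexx.
- apply: (Bb G w bG Gw) => x Wx; apply: lt_le_trans (FG x Wx) _.
  by rewrite lecR ge_min lexx orbT.
Qed.

Lemma analytic_open_bigU (I : Type) (f : I -> set analytic_field) :
  (forall i, analytic_open (f i)) -> analytic_open (\bigcup_i f i).
Proof.
move=> of_ W nW F v bF Fv [i _ fiv].
have [e e0 fe] := of_ i W nW F v bF Fv fiv.
by exists e => // G w bG Gw FG; exists i => //; exact: fe FG.
Qed.

HB.instance Definition _ := isOpenTopological.Build analytic_field
  analytic_openT analytic_openI analytic_open_bigU.

(* The torus being compact, every maximal integral curve is defined on R. *)
Definition integral_curve (v : torus R -> R * R) (gamma : R -> torus R) :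
    Prop :=
  exists2 c : R -> R * R, gamma = @torus_pi R \o c &
    forall t : R, is_derive t 1 c (v (gamma t)).

End vector_fields.

Definition homeomorphism (S T : topologicalType) (H : S -> T) : Prop :=
  continuous H /\ exists2 H' : T -> S, continuous H' & cancel H H' /\ cancel H' H.

Definition homotopic (R : realType) (S T : topologicalType) (f g : S -> T) :
    Prop :=
  exists F : R * S -> T,
    [/\ {within `[0, 1]%classic `*` [set: S], continuous F},
        forall x, F (0, x) = f x & forall x, F (1, x) = g x].

(* H maps orbits of v onto orbits of w and respects their time orientation: up to
   an increasing reparametrization s of R, H maps the integral curves of v to
   integral curves of w. *)
Definition maps_orbits (R : realType) (v w : torus R -> R * R)
    (H : torus R -> torus R) : Prop :=
  forall gamma, integral_curve v gamma ->
  exists delta, integral_curve w delta /\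
    exists s : R -> R, [/\ {homo s : t u / t < u}, range s = setT &
      forall t, H (gamma t) = delta (s t)].

Definition orbitally_equivalent (R : realType) (v w : torus R -> R * R) :
    Prop :=
  exists H : torus R -> torus R,
    [/\ homeomorphism H, homotopic R H id & maps_orbits v w H].

Definition is_metric (R : realType) (Y : Type) (d : Y -> Y -> R) : Prop :=
  [/\ forall x y, (d x y = 0) <-> (x = y),
      forall x y, d x y = d y x &
      forall x y z, d x z <= d x y + d y z].

Definition metrizes (R : realType) (Y : topologicalType) (d : Y -> Y -> R) :
    Prop :=
  forall U : set Y, open U <->
    (forall x, U x -> exists2 e : R, 0 < e & [set y | d x y < e] `<=` U).

Definition complete_metric (R : realType) (Y : topologicalType)
    (d : Y -> Y -> R) : Prop :=
  forall u : nat -> Y,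
    (forall e : R, 0 < e -> exists N : nat, forall m n : nat,
       (N <= m)%N -> (N <= n)%N -> d (u m) (u n) < e) ->
    exists l : Y, u @ \oo --> l.

Definition polish (R : realType) (Y : topologicalType) : Prop :=
  (exists2 D : set Y, countable D & dense D) /\
  (exists d : Y -> Y -> R, [/\ is_metric d, metrizes d & complete_metric d]).

Definition borel_set (T : topologicalType) : set (set T) :=
  <<s [set U : set T | open U] >>.

Definition borel_function (S T : topologicalType) (g : S -> T) : Prop :=
  forall U : set T, open U -> borel_set (g @^-1` U).

(* Main.v *)
Require Import Defs.
From mathcomp Require Import all_boot all_order all_algebra.
From mathcomp Require Import generic_quotient complex ring lra.
From mathcomp Require Import all_classical all_reals all_analysis.

Set Implicit Arguments.
Unset Strict Implicit.
Unset Printing Implicit Defensive.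

Import Order.TTheory GRing.Theory Num.Theory.
Import numFieldNormedType.Exports.

Local Open Scope classical_set_scope.
Local Open Scope ring_scope.
Local Open Scope quotient_scope.

(** Consider on the torus the linear flow of a fixed irrational direction
    [dir = (1, slope)], slowed down by a nonnegative trigonometric polynomial that
    vanishes exactly at the origin and at the point [(0, b)]. This gives a continuous
    family [pinched b] of analytic vector fields indexed by the line.

    Let [slope_group] be the countable dense subgroup of the line generated by 1 and
    [slope]. For [b] outside it, the orbital equivalence class of [pinched b] depends
    only on [b] modulo [slope_group], and determines it up to sign:
    - The second singular point can be pushed along its own line without reaching
      the origin, by a homeomorphism preserving all lines of direction [dir]
      ([slide_orbitally_equivalent]). After winding around the torus it comes back to
      the circle of the points [(0, b)] at a translate of [b] by [slope]. The change of
      parametrization along the orbits rests on the theory of scalar autonomous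
      equations ([time_change]).
    - Conversely, an equivalence homotopic to the identity is [z + D z] in the plane
      with [D] periodic ([homotopic_displacement]). It preserves the foliation by lines,
      so the component of [D] transverse to the foliation is constant on a dense line,
      hence everywhere; as singular points go to singular points, [b] is determined up
      to sign modulo [slope_group] ([rigidity]).

    A Borel invariant [g] would thus be a Borel function of [b], invariant under a dense
    group of translations. Preimages of open sets have the Baire property, hence are
    meager or comeager ([zero_one_law]); with countably many open sets separating the
    values of [g], it follows that [g (pinched b)] is constant on a comeager set of [b].
    This is absurd: outside [slope_group] the fibres of this function of [b] are
    countable, and a comeager set minus a countable set is nonempty by Baire's
    theorem. *)

(** * Autonomous equations on the line *)

Section ode.
Variable R : realType.
Implicit Types (f F h k phi : R -> R) (C : set R).

Lemma is_derive_continuous f (x l : R) : is_derive x 1 f l -> {for x, continuous f}.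
Proof. by move=> [df _]; apply: differentiable_continuous; exact/derivable1_diffP. Qed.

Lemma mean_value f df (a b : R) : a < b ->
  (forall x : R, a <= x <= b -> is_derive x 1 f (df x)) ->
  exists2 c, a < c < b & f b - f a = df c * (b - a).
Proof.
move=> ab fdf; have [||c] := @MVT R f df a b ab.
- by move=> x; rewrite in_itv/= => /andP[ax xb]; apply: fdf; rewrite !ltW.
- apply: continuous_in_subspaceT => x; rewrite inE/= in_itv/= => xab.
  by apply: is_derive_continuous (fdf x xab).
by rewrite in_itv/=; exists c.
Qed.

Lemma intermediate_value f (a b v : R) : continuous f -> a <= b ->
  (f a <= v <= f b) || (f b <= v <= f a) -> exists2 c, a <= c <= b & f c = v.
Proof.
move=> fc ab fv; have [||c] := @IVT R f a b v ab.
- exact: continuous_subspaceT.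
- by rewrite ge_min le_max; case/orP: fv => /andP[-> ->]; rewrite ?orbT.
by rewrite in_itv/=; exists c.
Qed.

(** The primitive is the integral from [x0]; near a given point of [C] it
    differs by a constant from the integral from a lower end of a compact
    subinterval, to which the fundamental theorem of calculus applies. *)
Lemma primitive C k (x0 : R) : is_interval C -> open C -> C x0 ->
  (forall y, C y -> {for y, continuous k}) ->
  exists F, forall y : R, C y -> is_derive y 1 F (k y).
Proof.
move=> iC oC Cx0 kc.
pose mu := @lebesgue_measure R.
pose F y : R := if x0 <= y then (\int[mu]_(t in `]x0, y]) k t)%R
                else - (\int[mu]_(t in `]y, x0]) k t)%R.
exists F => y Cy.
have room z : C z -> exists2 e : R, 0 < e & forall w, `|w - z| <= e -> C w.
  move=> Cz; have := oC; rewrite openE => /(_ _ Cz) /nbhs_ballP[e /= e0 eC].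
  exists (e / 2); first lra.
  by move=> w wz; apply: eC; rewrite -ball_normE /= distrC; lra.
have [d d0 dC] := room _ Cx0; have [e e0 eC] := room _ Cy.
have [p [q [[px0 py] [qx0 qy] Cp Cq]]] :
    exists p q, [/\ p < x0 /\ p < y, x0 < q /\ y < q, C p & C q].
  have [dl dr] : C (x0 - d) /\ C (x0 + d).
    by split; apply: dC; rewrite addrAC subrr add0r ?normrN gtr0_norm.
  have [el er] : C (y - e) /\ C (y + e).
    by split; apply: eC; rewrite addrAC subrr add0r ?normrN gtr0_norm.
  case: (leP x0 y) => xy.
    by exists (x0 - d), (y + e); split => //; split; lra.
  by exists (y - e), (x0 + d); split => //; split; lra.
have Cpq z : p <= z <= q -> C z by move=> pzq; exact: iC pzq.
have ki : mu.-integrable `[p, q] (EFin \o k).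
  apply: continuous_compact_integrable; first exact: segment_compact.
  apply: continuous_in_subspaceT => z; rewrite inE/= in_itv/= => zpq.
  exact/kc/Cpq.
have kiS z : z <= q -> mu.-integrable `[p, z] (EFin \o k).
  move=> zq; apply: integrableS ki => //.
  by apply: subset_itvl; rewrite bnd_simp.
pose I z := (\int[mu]_(t in `[p, z]) k t)%R.
have IF z : p <= z <= q -> F z = I z - I x0.
  move=> /andP[pz zq]; rewrite /F /I; case: leP => xz.
    by rewrite Rintegral_itvB ?bnd_simp//; [exact: kiS|exact: ltW].
  by rewrite -opprB Rintegral_itvB ?bnd_simp//; [exact/kiS/ltW|exact: ltW].
have [dI I'] : derivable I y 1 /\ derive1 I y = k y.
  exact: (@continuous_FTC1_closed R k p y q qy ki py (kc _ Cy)).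
clearbody I; have Iy : is_derive y 1 I (k y) by apply: DeriveDef dI _; rewrite -derive1E.
have : is_derive y 1 (I - cst (I x0)) (k y).
  by apply: is_derive_eq; rewrite subr0.
apply: near_eq_is_derive; near=> z; rewrite IF//; apply/andP; split; apply: ltW; near: z.
- exact: lt_nbhsr.
- exact: lt_nbhsl.
Unshelve. all: by end_near. Qed.

(** For [h >= 0] and [0 < h x0], the orbit of [x0] under the flow of [h] on the
    line. *)
Definition component h (x0 : R) : set R :=
  [set y | forall z, Num.min x0 y <= z <= Num.max x0 y -> 0 < h z].

Lemma component_refl h x0 : 0 < h x0 -> component h x0 x0.
Proof.
move=> hx z; rewrite minxx maxxx => ?; suff -> : z = x0 by [].
by apply/eqP; rewrite eq_le andbC.
Qed.

Lemma component_gt0 h x0 y : component h x0 y -> 0 < h y.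
Proof. by apply; rewrite ge_min le_max lexx !orbT. Qed.

Lemma component_interval h x0 : is_interval (component h x0).
Proof.
move=> a b Ca Cb c /andP[ac cb] z /andP[].
rewrite ge_min le_max => /orP z1 /orP z2.
case: (leP x0 z) => xz.
- apply: Cb; rewrite ge_min le_max xz /=.
  by case: z2 => [->//|/le_trans/(_ cb)->]; rewrite ?orbT.
- apply: Ca; rewrite ge_min le_max (ltW xz) /= andbT.
  by case: z1 => [|/(le_trans ac) ->]; [rewrite leNgt xz | rewrite orbT].
Qed.

Section lipschitz_field.
Variables (h : R -> R) (K M : R).
Hypothesis K0 : 0 < K.
Hypothesis hK : forall x y, `|h x - h y| <= K * `|x - y|.
Hypothesis hM : forall x, 0 <= h x <= M.

Lemma lipschitz_field_continuous : continuous h.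
Proof.
move=> x; apply/cvgrPdist_lt => e e0; near=> y.
apply: le_lt_trans (hK x y) _; rewrite mulrC -ltr_pdivlMr//.
near: y; apply: (@cvgr_dist_lt _ _ _ _ _ id) => //.
by rewrite divr_gt0.
Unshelve. all: by end_near. Qed.

Lemma lipschitz_pos x : 0 < h x ->
  forall y, `|y - x| < h x / K -> 0 < h y.
Proof.
move=> hx y; rewrite ltr_pdivlMr// mulrC => yx.
have := le_lt_trans (hK y x) yx; rewrite ltr_norml; lra.
Qed.

Lemma component_open x0 : open (component h x0).
Proof.
rewrite openE => y Cy; have hy := component_gt0 Cy.
apply/nbhs_ballP; exists (h y / K) => /=; first by rewrite divr_gt0.
move=> w; rewrite -ball_normE /= distrC => yw z /andP[].
rewrite ge_min le_max => z1 z2.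
have [zC|zC] := boolP (Num.min x0 y <= z <= Num.max x0 y); first exact: Cy.
apply: (lipschitz_pos hy); apply: le_lt_trans yw.
move: zC; rewrite ge_min le_max.
rewrite ler_norml; case: (leP y w) => yw.
  by rewrite [`|w - y|]ger0_norm ?subr_ge0//; lra.
by rewrite [`|w - y|]ltr0_norm ?subr_lt0//; lra.
Qed.

(** A zero [b] of [h] is approached no faster than exponentially, because
    [h z <= K * (b - z)]: the time needed is infinite. Without
    such a zero it is infinite because [h <= M]. *)
Lemma time_unbounded x0 F :
  0 < h x0 -> (forall y, component h x0 y -> is_derive y 1 F (h y)^-1) ->
  forall T, exists2 y, component h x0 y & T <= F y.
Proof.
move=> hx0 dF T; pose C := component h x0.
have Cx0 : C x0 := component_refl hx0.
apply: contrapT => noT.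
have FT y : C y -> F y < T.
  by move=> Cy; rewrite ltNge; apply/negP => Ty; apply: noT; exists y.
have M0 : 0 < M by have := hM x0; lra.
have bd y : C y -> y <= x0 + M * (T - F x0).
  move=> Cy; case: (leP y x0) => [yx|xy].
    by apply: le_trans yx _; rewrite lerDl mulr_ge0 ?subr_ge0 1?ltW ?FT.
  have [|c xcy Fc] := @mean_value F (fun z => (h z)^-1) x0 y xy.
    by move=> z xz; apply: dF; exact: component_interval Cx0 Cy _ xz.
  have Cc : C c by apply: component_interval Cx0 Cy _ _; lra.
  have yE : y - x0 = h c * (F y - F x0).
    by rewrite Fc mulrA divff ?mul1r// gt_eqF// (component_gt0 Cc).
  have hc := component_gt0 Cc; have /andP[_ hcM] := hM c.
  have F0 : 0 < F y - F x0 by rewrite -(pmulr_rgt0 _ hc) -yE subr_gt0.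
  rewrite -lerBlDl yE; apply: ler_pM => //; [exact: ltW..|].
  by rewrite lerD2r ltW ?FT.
pose A := [set y | C y /\ x0 <= y].
have Asup : has_sup A.
  split; first by exists x0.
  by exists (x0 + M * (T - F x0)); move=> z [/bd].
pose b := sup A.
have Ab y : A y -> y <= b by move=> Ay; apply: ub_le_sup => //; exact: Asup.2.
have xb : x0 <= b by apply: Ab.
have Cb y : x0 <= y < b -> C y.
  move=> /andP[xy yb]; have [|z [Cz xz] yz] := @sup_adherent _ A (b - y) _ Asup.
    by rewrite subr_gt0.
  apply: component_interval Cx0 Cz _ _; rewrite xy /=; rewrite -/b in yz; lra.
have hb : h b = 0.
  apply/eqP; rewrite eq_le (andP (hM b)).1 andbT leNgt; apply/negP => hb.
  pose e := h b / K / 2.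
  have e0 : 0 < e by rewrite !divr_gt0.
  have : A (b + e).
    split; last lra.
    move=> z; rewrite min_l ?max_r; [|lra..] => xz.
    case: (ltP z b) => zb; first by apply: component_gt0 (Cb _ _); lra.
    by apply: lipschitz_pos hb _ _; rewrite ger0_norm; rewrite /e in xz e0; lra.
  by move=> /Ab; lra.
have xb' : x0 < b.
  by rewrite lt_neqAle xb andbT; apply/eqP => xE; rewrite -xE in hb; lra.
(* [G] is nondecreasing because [h z <= K * (b - z)], while [F] must compensate
   for the divergence of [ln] at 0. The point [b - c] is chosen so that
   [G x0 <= G (b - c)] reads [T <= F (b - c)]. *)
pose G y := F y + K^-1 * ln (b - y).
pose c := (b - x0) * expR (- (K * (T - F x0))).
have c0 : 0 < c by rewrite mulr_gt0 ?expR_gt0// subr_gt0.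
have cb : c < b - x0.
  rewrite /c gtr_pMr ?subr_gt0// expR_lt1 oppr_lt0 mulr_gt0// subr_gt0.
  exact: FT.
have bc : x0 < b - c by lra.
have [|z /andP[z1 z2]] := @mean_value G (fun y => (h y)^-1 - (K * (b - y))^-1) _ _ bc.
  move=> y xyb; apply: is_derive_eq.
    apply: is_deriveD; first by apply: dF; apply: Cb; lra.
    apply: is_deriveZ; apply: is_derive1_comp; apply: is_derive1_ln; lra.
  rewrite invfM /= /GRing.scale /=; lra.
have hz : h z <= K * (b - z).
  have := hK z b; rewrite hb subr0 ger0_norm ?(andP (hM z)).1//.
  by rewrite distrC ger0_norm //; lra.
have hz0 : 0 < h z by apply: component_gt0 (Cb _ _); lra.
have : 0 <= (h z)^-1 - (K * (b - z))^-1.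
  by rewrite subr_ge0 lef_pV2// posrE mulr_gt0//; lra.
have FTc : F (b - c) < T by apply: FT; apply: Cb; lra.
have Gc : G (b - c) = F (b - c) + K^-1 * ln (b - x0) - (T - F x0).
  rewrite /G subKr /c lnM ?posrE ?expR_gt0 ?subr_gt0// expRK.
  by field; rewrite gt_eqF.
rewrite Gc /G; nra.
Qed.


(** Gronwall's inequality for the squared distance to the rest point. *)
Lemma rest_point_unique phi (z t1 : R) :
  (forall t : R, is_derive t 1 phi (h (phi t))) -> h z = 0 -> phi t1 = z ->
  forall t, phi t = z.
Proof.
move=> dphi hz phiz t.
pose u s := (phi s - z) ^+ 2.
have du (a s : R) : is_derive s 1 (fun s => u s * expR (a * s))
    ((2 * (phi s - z) * h (phi s) + a * u s) * expR (a * s)).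
  apply: is_derive_eq; rewrite /u /GRing.scale /=; ring.
have hu s : `|2 * (phi s - z) * h (phi s)| <= 2 * K * u s.
  have := hK (phi s) z; rewrite hz subr0 => le.
  rewrite !normrM ger0_norm// /u -real_normK ?num_real// expr2.
  have := normr_ge0 (phi s - z); nra.
have u0 s : 0 <= u s by rewrite sqr_ge0.
suff : u t = 0 by move/eqP; rewrite sqrf_eq0 subr_eq0 => /eqP.
have ut1 : u t1 = 0 by rewrite /u phiz subrr expr0n.
apply/eqP; rewrite eq_le u0 andbT.
case: (ltgtP t1 t) => [lt|lt|<-]; last by rewrite ut1.
- have [c _] := mean_value lt (fun s _ => du (- (2 * K)) s).
  rewrite ut1 mul0r subr0 => uE.
  rewrite -(pmulr_lle0 _ (expR_gt0 (- (2 * K) * t))) uE.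
  rewrite pmulr_lle0 ?subr_gt0// pmulr_lle0 ?expR_gt0//.
  by have := hu c; rewrite ler_norml; lra.
- have [c _] := mean_value lt (fun s _ => du (2 * K) s).
  rewrite ut1 mul0r sub0r => uE.
  rewrite -(pmulr_lle0 _ (expR_gt0 (2 * K * t))) -oppr_ge0 uE.
  rewrite pmulr_lge0 ?subr_gt0// pmulr_lge0 ?expR_gt0//.
  by have := hu c; rewrite ler_norml; lra.
Qed.

(** By uniqueness at the zeros of [h] a solution never leaves its component,
    where the time coordinate has derivative 1 along it. *)
Lemma solution_time phi F :
  (forall t : R, is_derive t 1 phi (h (phi t))) -> 0 < h (phi 0) ->
  (forall y, component h (phi 0) y -> is_derive y 1 F (h y)^-1) ->
  forall t, component h (phi 0) (phi t) /\ F (phi t) = F (phi 0) + t.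
Proof.
move=> dphi h0 dF.
have cphi : continuous phi by move=> t; exact: is_derive_continuous (dphi t).
have Cphi t : component h (phi 0) (phi t).
  move=> z zI; rewrite lt_neqAle (andP (hM z)).1 andbT; apply/negP => /eqP hz.
  have [t1 tz] : exists t1, phi t1 = z.
    have [t0|t0] := leP 0 t.
      have [|c _] := @intermediate_value phi 0 t z cphi t0; last by exists c.
      by move: zI; rewrite ge_min le_max; lra.
    have [|c _] := @intermediate_value phi t 0 z cphi (ltW t0); last by exists c.
    by move: zI; rewrite ge_min le_max; lra.
  have := rest_point_unique dphi (esym hz) tz 0; move: h0 => /[swap] ->.
  by rewrite -hz ltxx.
move=> t; split=> //.
suff : F (phi t) - t = F (phi 0) - 0 by lra.
apply: (@is_derive_0_is_cst R (fun t => F (phi t) - t)) => s.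
have Fphi : is_derive s 1 (F \o phi) ((h (phi s))^-1 * h (phi s)).
  by apply: is_derive1_comp; apply: dF.
apply: is_derive_eq.
by rewrite mulVf ?subrr// gt_eqF// (component_gt0 (Cphi s)).
Qed.

End lipschitz_field.
End ode.

Section time_coordinate.
Variable R : realType.
Variables (h : R -> R) (K M : R).
Hypothesis K0 : 0 < K.
Hypothesis hK : forall x y, `|h x - h y| <= K * `|x - y|.
Hypothesis hM : forall x, 0 <= h x <= M.

(** The time that the flow of [h] needs to come from [x0], a primitive of [h^-1];
    the descending half of surjectivity is [time_unbounded] for the reflected
    field. *)
Lemma time_coordinate x0 : 0 < h x0 ->
  exists F : R -> R,
    [/\ forall y, component h x0 y -> is_derive y 1 F (h y)^-1,
        forall y z, component h x0 y -> component h x0 z -> y < z -> F y < F z &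
        forall t, exists2 y, component h x0 y & F y = t].
Proof.
move=> hx0; set C := component h x0.
have Cx0 : C x0 := component_refl hx0.
have iC : is_interval C by exact: component_interval.
have oC : open C by exact: (component_open K0 hK).
have hC y : C y -> 0 < h y by exact: component_gt0.
have [F dF] : exists F : R -> R, forall y, C y -> is_derive y 1 F (h y)^-1.
  apply: primitive Cx0 _ => // y /hC hy.
  by apply: continuousV; [rewrite gt_eqF|exact: lipschitz_field_continuous K0 hK y].
have Fhomo y z : C y -> C z -> y < z -> F y < F z.
  move=> Cy Cz yz; have [|c yz'] := @mean_value R F (fun y => (h y)^-1) y z yz.
    by move=> w; move=> yz'; apply: dF; exact: iC Cy Cz _ yz'.
  rewrite -subr_gt0 => ->; rewrite mulr_gt0 ?subr_gt0// invr_gt0; apply: hC.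
  by apply: iC Cy Cz _ _; lra.
exists F; split=> // t.
have [b Cb Fb] := time_unbounded K0 hK hM hx0 dF t.
have [a Ca Fa] : exists2 a, C a & F a <= t.
  pose k y := h (- y); pose G y := - F (- y).
  have Ck y : component k (- x0) y -> C (- y).
    by move=> Cy z zI; rewrite -[z]opprK; apply: Cy; move: zI; rewrite !ge_min !le_max; lra.
  have [||||y Cy] := @time_unbounded R k K M K0 _ _ (- x0) G _ _ (- t).
  - by move=> x y; apply: le_trans (hK _ _) _; rewrite -opprD normrN.
  - by move=> x; exact: hM.
  - by rewrite /k opprK.
  - move=> y /Ck/dF dFy; apply: is_derive_eq.
    by rewrite /k; lra.
  by rewrite lerN2 => Fy; exists (- y) => //; exact: Ck.
have FC p q : C p -> C q -> p <= q -> F p <= t <= F q -> exists2 y, C y & F y = t.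
  move=> Cp Cq pq /andP[Fp Fq].
  have [||c] := @IVT R F p q t pq.
  - apply: continuous_in_subspaceT => z; rewrite inE/= in_itv/= => zpq.
    by apply: is_derive_continuous (dF z _); exact: iC Cp Cq _ zpq.
  - by rewrite ge_min le_max Fp Fq orbT.
  by rewrite in_itv/= => cpq <-; exists c => //; exact: iC Cp Cq _ cpq.
case: (leP a b) => [ab|ba]; first by apply: FC Ca Cb ab _; rewrite Fa Fb.
exists b => //; apply/eqP; rewrite eq_le Fb andbT (le_trans _ Fa)//.
exact/ltW/Fhomo.
Qed.

(** Solving the equation amounts to inverting the time coordinate. *)
Lemma solution_exists (x0 : R) (F : R -> R) : 0 < h x0 ->
  (forall y, component h x0 y -> is_derive y 1 F (h y)^-1) ->
  (forall y z, component h x0 y -> component h x0 z -> y < z -> F y < F z) ->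
  (forall t, exists2 y, component h x0 y & F y = t) ->
  exists D : R -> R, [/\ forall t, component h x0 (D t),
    forall y, component h x0 y -> D (F y) = y &
    forall t : R, is_derive t 1 D (h (D t))].
Proof.
move=> hx0 dF Fhomo Fonto; pose C := component h x0.
have Finj y z : C y -> C z -> F y = F z -> y = z.
  move=> Cy Cz FE; case: (ltgtP y z) => // yz.
    by have := Fhomo _ _ Cy Cz yz; rewrite FE ltxx.
  by have := Fhomo _ _ Cz Cy yz; rewrite FE ltxx.
have /choice[D DP] t : exists y, C y /\ F y = t.
  by have [y Cy Fy] := Fonto t; exists y.
have DK y : C y -> D (F y) = y by move=> Cy; apply: Finj => //; apply DP.
exists D; split=> // [t|t]; first exact: (DP t).1.
have [CD FD] := DP t.
rewrite -{1}FD -[h _]invrK.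
have nC : nbhs (D t) C by exact: (open_nbhs_nbhs (conj (component_open K0 hK (x0:=x0)) CD)).
apply: is_derive_inverse.
- by apply: filterS nC => y; exact: DK.
- by apply: filterS nC => y Cy; exact: is_derive_continuous (dF y Cy).
- exact: dF.
- by rewrite invr_eq0 gt_eqF// (component_gt0 CD).
Qed.

End time_coordinate.

Section time_change.
Variable R : realType.
Variables (h k : R -> R) (K M : R).
Hypothesis K0 : 0 < K.
Hypothesis hK : forall x y, `|h x - h y| <= K * `|x - y|.
Hypothesis kK : forall x y, `|k x - k y| <= K * `|x - y|.
Hypothesis hM : forall x, 0 <= h x <= M.
Hypothesis kM : forall x, 0 <= k x <= M.

(** A homeomorphism of the line that matches the zeros of two fields matches
    their orbits. *)
Lemma component_homeo (theta : R -> R) x0 y :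
  {mono theta : x y / x <= y} -> range theta = setT ->
  (forall r, h r = 0 <-> k (theta r) = 0) ->
  component h x0 y <-> component k (theta x0) (theta y).
Proof.
move=> thm tho hk.
have pos r : 0 < h r <-> 0 < k (theta r).
  rewrite !lt_neqAle (andP (hM _)).1 (andP (kM _)).1 !andbT.
  by split; apply: contraNN => /eqP/esym/hk/esym/eqP.
have minE a b : theta (Num.min a b) = Num.min (theta a) (theta b).
  by rewrite !minEle thm; case: ifP.
have maxE a b : theta (Num.max a b) = Num.max (theta a) (theta b).
  by rewrite !maxEle thm; case: ifP.
split=> [Cy z|Cy z zI]; last by apply/pos/Cy; rewrite -minE -maxE !thm.
have [r _ <-] : range theta z by rewrite tho.
by rewrite -minE -maxE !thm => rI; apply/pos; exact: Cy.
Qed.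

(** This is what turns a homeomorphism between lines into an orbital equivalence:
    the image of a complete orbit is again a complete orbit, and the change of
    time is [G o theta o phi], with [G] the time coordinate of the target. *)
Lemma time_change (theta phi : R -> R) :
  {mono theta : x y / x <= y} -> range theta = setT ->
  (forall r, h r = 0 <-> k (theta r) = 0) ->
  (forall t : R, is_derive t 1 phi (h (phi t))) -> 0 < h (phi 0) ->
  exists D s : R -> R, [/\ forall t : R, is_derive t 1 D (k (D t)),
    {homo s : t u / t < u}, range s = setT &
    forall t, theta (phi t) = D (s t)].
Proof.
move=> thm tho hk dphi h0; set x0 := phi 0 in h0.
have k0 : 0 < k (theta x0).
  by apply: component_gt0 ((component_homeo _ _ thm tho hk).1 (component_refl h0)).
have [F [dF Fhomo Fonto]] := time_coordinate K0 hK hM h0.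
have [G [dG Ghomo Gonto]] := time_coordinate K0 kK kM k0.
have [D [CD DK dD]] := solution_exists K0 kK k0 dG Ghomo Gonto.
have tphi := solution_time hK hM dphi h0 dF.
have Cth t : component k (theta x0) (theta (phi t)).
  by apply: (component_homeo _ _ thm tho hk).1; exact: (tphi t).1.
have Fmono y z : component h x0 y -> component h x0 z -> F y < F z -> y < z.
  move=> Cy Cz; rewrite !ltNge; apply: contraNN; rewrite le_eqVlt.
  by move=> /orP[/eqP->//|/(Fhomo _ _ Cz Cy)/ltW].
exists D, (fun t => G (theta (phi t))); split=> // [t t' tt'||t].
- apply: Ghomo => //; rewrite (leW_mono thm).
  have [Ct Ft] := tphi t; have [Ct' Ft'] := tphi t'.
  by apply: Fmono => //; rewrite Ft Ft' ltrD2l.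
- apply/seteqP; split=> // s _.
  have [y Cy <-] := Gonto s.
  have [r _ rE] : range theta y by rewrite tho.
  have Cr : component h x0 r.
    by apply: (component_homeo _ _ thm tho hk).2; rewrite rE.
  exists (F r - F x0) => //; rewrite -rE; congr (G (theta _)).
  have [Cp] := tphi (F r - F x0); rewrite -/x0 subrKC => FE.
  by apply/eqP; rewrite eq_le !leNgt; apply/andP; split; apply/negP => /Fhomo;
     rewrite FE ltxx => /(_ _ _)/negP; apply.
- by rewrite DK.
Qed.

End time_change.

(** * Topology of the torus *)

Section torus_topology.

Lemma torus_pi_eqP (K : numFieldType) (p q : K * K) :
  torus_pi p = torus_pi q <-> exists m n : int, p - q = (m%:~R, n%:~R).
Proof.
rewrite /torus_pi; split=> [/eqmodP/asboolW//|pq].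
by apply/eqmodP/asboolT.
Qed.

Lemma torus_piK (K : numFieldType) (x : torus K) : torus_pi (repr x) = x.
Proof. exact: reprK. Qed.

Lemma torus_pi_continuous (K : numFieldType) : continuous (@torus_pi K).
Proof. exact: pi_continuous. Qed.

Lemma torus_piD (K : numFieldType) (p : K * K) (m n : int) :
  torus_pi (p + (m%:~R, n%:~R)) = torus_pi p.
Proof. by apply/torus_pi_eqP; exists m, n; rewrite addrAC subrr add0r. Qed.

Lemma open_torus (K : numFieldType) (U : set (torus K)) :
  open U <-> open (@torus_pi K @^-1` U).
Proof. by []. Qed.

Definition torus_periodic (K : numFieldType) (A : Type) (f : K * K -> A) :=
  forall p (m n : int), f (p + (m%:~R, n%:~R)) = f p.

Lemma periodic_eq (K : numFieldType) (A : Type) (f : K * K -> A) p q :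
  torus_periodic f -> torus_pi p = torus_pi q -> f p = f q.
Proof. by move=> fP /torus_pi_eqP[m [n pq]]; rewrite -(fP q m n) -pq subrKC. Qed.

Lemma periodic_repr (K : numFieldType) (A : Type) (f : K * K -> A) p :
  torus_periodic f -> f (repr (torus_pi p)) = f p.
Proof. by move=> fP; apply: periodic_eq fP _; exact: torus_piK. Qed.

(** The saturation of an open set is the union of its integer translates. *)
Lemma torus_pi_open (K : numFieldType) (p : K * K) (U : set (K * K)) :
  nbhs p U -> nbhs (torus_pi p) (@torus_pi K @` U).
Proof.
rewrite nbhsE => -[V [oV Vp] VU]; rewrite nbhsE.
exists (@torus_pi K @` V); last by apply: image_subset.
split; last by exists p.
apply/open_torus.
have -> : @torus_pi K @^-1` (@torus_pi K @` V) =
    \bigcup_(mn : int * int) [set q | V (q + (mn.1%:~R, mn.2%:~R))].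
  apply/seteqP; split=> q /=.
    by move=> [v Vv /torus_pi_eqP[m [n vq]]]; exists (m, n) => //=; rewrite -vq subrKC.
  by move=> [[m n] _ /= Vq]; exists (q + (m%:~R, n%:~R)) => //; exact: torus_piD.
apply: bigcup_open => -[m n] _ /=.
apply: (@open_comp _ _ (fun q : K * K => q + (m%:~R, n%:~R))) => // q _.
by apply: continuousD; [exact: cvg_id|exact: cvg_cst].
Qed.

Lemma torus_compact (R : realType) : compact [set: torus R].
Proof.
have -> : [set: torus R] = @torus_pi R @` (`[0, 1] `*` `[0, 1]).
  apply/seteqP; split=> // x _; set p := repr x.
  exists (p + ((- Num.floor p.1)%:~R, (- Num.floor p.2)%:~R)); last first.
    by rewrite torus_piD torus_piK.
  have fl (a : R) : 0 <= a + (- Num.floor a)%:~R <= 1.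
    rewrite mulrNz subr_ge0 floor_le_tmp /= lerBlDr.
    by have := floorD1_gt a; rewrite intrD1 addrC => /ltW.
  by split=> /=; rewrite in_itv/= fl.
apply: continuous_compact.
  by apply: continuous_subspaceT; exact: torus_pi_continuous.
by apply: compact_setX; exact: segment_compact.
Qed.

End torus_topology.

(** * Maps homotopic to the identity have a displacement *)

Section displacement.
Variable R : realType.
Local Notation T := (torus R).
Implicit Types (A B H : T -> T) (z p q e : R * R).

(** A displacement of [H] is a lift of [H] to the plane that commutes with integer
    translations, minus the identity. *)
Definition displacement H (D : R * R -> R * R) :=
  [/\ continuous D, torus_periodic D &
      forall z, H (torus_pi z) = torus_pi (z + D z)].

Lemma prod_norm_lt z (c : R) : (`|z| < c) = (`|z.1| < c) && (`|z.2| < c).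
Proof. by rewrite prod_normE gt_max. Qed.

(** The indicator of each fibre has derivative 0. The codomain has no structure, so
    that the lemma applies both to truth values and to values of an invariant. *)
Lemma locally_constant (X : Type) (f : R -> X) :
  (forall t : R, \forall u \near t, f u = f t) -> forall t u, f t = f u.
Proof.
move=> fc t u; pose g v : R := (`[< f v = f u >])%:R.
have : g t = g u.
  apply: is_derive_0_is_cst => v.
  apply: (@near_eq_is_derive R R R (cst (g v)) g v 1 0).
  by near=> w; rewrite /g /= (_ : f w = f v)//; near: w; exact: fc.
rewrite /g (asboolT (erefl _)); case: asboolP => // _ /eqP.
by rewrite eq_sym oner_eq0.
Unshelve. all: by end_near. Qed.

Lemma small_lift_unique z e e' : `|e| < 1 / 4 -> `|e'| < 1 / 4 ->
  torus_pi (z + e) = torus_pi (z + e') -> e = e'.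
Proof.
rewrite !prod_norm_lt => /andP[e1 e2] /andP[e1' e2'] /torus_pi_eqP[m [n]].
rewrite opprD addrACA subrr add0r => ee.
have int0 (k : int) : `|k%:~R : R| < 1 -> k = 0.
  by rewrite -intr_norm ltrz1 -[1]add0r ltzD1 normr_le0 => /eqP.
have [mE nE] : m = 0 /\ n = 0.
  by split; apply: int0; [move: (congr1 fst ee)|move: (congr1 snd ee)] => /= <-;
    move: e1 e2 e1' e2'; rewrite !ltr_norml; lra.
by apply/eqP; rewrite -subr_eq0 ee mE nE.
Qed.

(** Two maps closer than [1 / 4] differ by a unique small vector, and uniqueness
    makes that vector continuous and periodic. *)
Lemma displacement_close A B D : continuous B -> displacement A D ->
  (forall x, exists p q, [/\ A x = torus_pi p, B x = torus_pi q & `|q - p| < 1 / 4]) ->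
  exists E, displacement B E.
Proof.
move=> Bc [Dc Dp DA] AB.
have /choice[d dP] z : exists e, `|e| < 1 / 4 /\ B (torus_pi z) = torus_pi (z + D z + e).
  have [p [q [/esym Ap Bq qp]]] := AB (torus_pi z).
  move: Ap; rewrite DA => /torus_pi_eqP[m [n pE]].
  exists (q - p); split=> //.
  have -> : z + D z + (q - p) = q + ((- m)%:~R, (- n)%:~R).
    have -> : ((- m)%:~R, (- n)%:~R) = - (m%:~R, n%:~R) :> R * R.
      by rewrite !mulrNz.
    by rewrite -pE opprB addrCA addrA addrC addrA.
  by rewrite torus_piD.
have dE z e : `|e| < 1 / 4 -> B (torus_pi z) = torus_pi (z + D z + e) -> e = d z.
  move=> e4 Be; apply: (@small_lift_unique (z + D z)) => //; first exact: (dP z).1.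
  by rewrite -Be -(dP z).2.
have dp : torus_periodic d.
  move=> z m n; apply: dE; first exact: (dP _).1.
  have [_] := dP (z + (m%:~R, n%:~R)); rewrite torus_piD Dp => ->.
  by rewrite -[z + _ + _ + _]addrA [z + _ + _]addrAC torus_piD addrA.
exists (fun z => D z + d z); split=> [|z m n|z]; last 2 first.
- by rewrite Dp dp.
- by rewrite (dP z).2 addrA.
move=> z0; apply: continuousD; first exact: Dc.
apply/cvgrPdist_lt => eps eps0.
(* Within [2 * eta] of [d z0] a vector is within [eps] of it and shorter than
   [1 / 4], hence subject to uniqueness. *)
pose eta := Num.min eps (1 / 4 - `|d z0|) / 2.
have eta0 : 0 < eta.
  by rewrite divr_gt0// lt_min eps0 subr_gt0 (dP z0).1.
have Bnear : \forall z \near z0,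
    (@torus_pi R @` ball (z0 + D z0 + d z0) eta) (B (torus_pi z)).
  have : {for z0, continuous (B \o @torus_pi R)}.
    exact: (continuous_comp (@torus_pi_continuous R z0) (Bc _)).
  apply; rewrite /= (dP z0).2; apply: torus_pi_open; exact: nbhsx_ballx.
have Dnear : \forall z \near z0, `|(z0 + D z0) - (z + D z)| < eta.
  have : (fun z => z + D z) z @[z --> z0] --> z0 + D z0.
    by apply: continuousD; [exact: cvg_id|exact: Dc].
  by move=> /cvgrPdist_lt/(_ _ eta0).
near=> z.
have [y /=] : (@torus_pi R @` ball (z0 + D z0 + d z0) eta) (B (torus_pi z)) by near: z.
rewrite -ball_normE /= => yeta By.
have Dz : `|(z0 + D z0) - (z + D z)| < eta by near: z.
have dd : `|d z0 - (y - (z + D z))| < 2 * eta.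
  have -> : d z0 - (y - (z + D z)) =
     (z0 + D z0 + d z0 - y) - ((z0 + D z0) - (z + D z)).
    by apply: injective_projections => /=; ring.
  by rewrite mulrC mulr_natr; apply: le_lt_trans (ler_normB _ _) _; rewrite mulr2n ltrD.
have {}dd : `|d z0 - (y - (z + D z))| < Num.min eps (1 / 4 - `|d z0|).
  by move: dd; rewrite /eta mulrC divfK.
move: dd; rewrite lt_min => /andP[d1 d2].
suff <- : y - (z + D z) = d z by [].
apply: dE; last by rewrite subrKC.
rewrite -(subKr (d z0) (y - _)); apply: le_lt_trans (ler_normB _ _) _.
by rewrite -ltrBrDl.
Unshelve. all: by end_near. Qed.

(** The identity has displacement 0, and along the homotopy the existence of a
    displacement is locally constant in time: by compactness of the torus, the
    maps at nearby times are uniformly close. *)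
Lemma homotopic_displacement H : homotopic R H id -> exists D, displacement H D.
Proof.
move=> [F [Fc F0 F1]].
(* The homotopy is continuous only on [0, 1]; it is extended by constants. *)
pose clamp t : R := Num.max 0 (Num.min 1 t).
pose G t x := F (clamp t, x).
have clampc : continuous clamp.
  move=> t; apply: continuous_max; first exact: cvg_cst.
  by apply: continuous_min; [exact: cvg_cst|exact: cvg_id].
have Gc : continuous (fun p : R * T => G p.1 p.2).
  move=> p; move: Fc => /subspace_continuousP Fc.
  have Ac (p' : R * T) : (`[0, 1]%classic `*` [set: T]) (clamp p'.1, p'.2).
    by split=> //=; rewrite in_itv/= /clamp le_max lexx ge_max ler01 ge_min lexx.
  move=> U /(Fc _ (Ac p)); rewrite nbhs_simpl /within /= => nF.
  have : (clamp q.1, q.2) @[q --> p] --> (clamp p.1, p.2).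
    exact: (cvg_pair (@continuous_comp _ _ _ fst clamp p cvg_fst (clampc _)) cvg_snd).
  move=> /(_ _ nF) nG; apply: (@filterS _ (nbhs p) _ _ _ _ nG) => q.
  by move=> /(_ (Ac q)).
have Gtc t : continuous (G t).
  move=> x; have tx : (t, y) @[y --> x] --> (t, x).
    move=> W [[U V] /= [nU nV] UV]; apply: filterS nV => y Vy.
    by apply: UV; split=> //=; exact: nbhs_singleton.
  exact: (@continuous_comp _ _ _ (pair t) (fun p : R * T => G p.1 p.2) x tx (Gc _)).
pose P t := `[< exists D, displacement (G t) D >].
have Pcst : P 1 = P 0.
  apply: locally_constant => t0.
  have close : \forall t \near t0, forall x, exists p q,
      [/\ G t0 x = torus_pi p, G t x = torus_pi q & `|q - p| < 1 / 4].
    have /compact_near_coveringP/(_ R (nbhs t0)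
      (fun t x => exists p q, [/\ G t0 x = torus_pi p, G t x = torus_pi q & `|q - p| < 1 / 4])) :=
      @torus_compact R.
    move=> cov; suff N : \forall t \near t0, [set: T] `<=` (fun x => exists p q,
        [/\ G t0 x = torus_pi p, G t x = torus_pi q & `|q - p| < 1 / 4]).
      by apply: filterS N => t Nt x; exact: Nt.
    apply: cov => //.
    move=> x0 _; pose p0 := repr (G t0 x0).
    have nU : nbhs (G t0 x0) (@torus_pi R @` ball p0 (1 / 8)).
      by rewrite -(torus_piK (G t0 x0)); apply/torus_pi_open/nbhsx_ballx.
    have n1 := Gtc t0 x0 _ nU.
    have [[V W] [/= nV nW] VW] := Gc (t0, x0) _ nU.
    exists (W `&` G t0 @^-1` (@torus_pi R @` ball p0 (1 / 8)), V).
      by split=> //; exact: filterI.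
    move=> [x t] [/= [Wx [p pB Gp]] Vt].
    have [q qB Gq] := VW (t, x) (conj Vt Wx).
    exists p, q; split=> //.
    move: pB qB; rewrite -!ball_normE /= => pB qB.
    rewrite -(subrKA p0); apply: le_lt_trans (ler_normD _ _) _.
    by rewrite (distrC q p0); lra.
  near=> t; have tclose : forall x, exists p q,
      [/\ G t0 x = torus_pi p, G t x = torus_pi q & `|q - p| < 1 / 4] by near: t.
  apply: asbool_equiv_eq; split=> -[D DG].
  - apply: displacement_close DG _; first exact: Gtc.
    by move=> x; have [p [q [e1 e2 e3]]] := tclose x; exists q, p; rewrite distrC.
  - exact: displacement_close (Gtc t) DG tclose.
have : P 1.
  apply/asboolP; exists (cst 0); split=> //; first by move=> z; exact: cvg_cst.
  by move=> z; rewrite /G /clamp min_l// max_r// F1 addr0.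
rewrite Pcst => /asboolP[D DH]; exists D.
suff <- : G 0 = H by [].
by apply/funext => x; rewrite /G /clamp min_r// max_l// F0.
Unshelve. all: by end_near. Qed.

End displacement.

(** * Linear flows stopped at two points *)

Section pinched_fields.
Variable R : realType.
Implicit Types (q z c : R * R).

Lemma trig_int (m : int) :
  cos (2 * pi * m%:~R) = 1 :> R /\ sin (2 * pi * m%:~R) = 0 :> R.
Proof.
have nat_case (n : nat) : cos (2 * pi * n%:R) = 1 :> R /\ sin (2 * pi * n%:R) = 0 :> R.
  elim: n => [|n [IHc IHs]]; first by rewrite mulr0 cos0 sin0.
  have -> : 2 * pi * n.+1%:R = 2 * pi * n%:R + pi *+ 2 :> R.
    by rewrite -[n.+1%:R]natr1 mulr2n; ring.
  by rewrite cosD2pi sinD2pi.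
case: m => n; first exact: nat_case.
have [c s] := nat_case n.+1.
by rewrite NegzE mulrNz mulrN cosN sinN c s oppr0.
Qed.

Lemma cosDint (x : R) (m : int) : cos (2 * pi * (x + m%:~R)) = cos (2 * pi * x).
Proof.
by rewrite mulrDr cosD; have [-> ->] := trig_int m; rewrite mulr1 mulr0 subr0.
Qed.

(** Since [cos (2 * pi * x) = 1 - 2 * sin (pi * x) ^+ 2] and, after translation by
    an integer, [0 <= x < 1], this comes down to the zeros of [sin] in that range. *)
Lemma cos2pi_eq1 (x : R) : cos (2 * pi * x) = 1 -> exists m : int, x = m%:~R.
Proof.
move=> c1; exists (Num.floor x); pose y := x + (- Num.floor x)%:~R.
have : cos (2 * pi * y) = 1 by rewrite cosDint.
have y0 : 0 <= y by rewrite /y mulrNz subr_ge0 floor_le_tmp.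
have y1 : y < 1 by rewrite /y mulrNz ltrBlDr addrC -intrD1 floorD1_gt.
have -> : 2 * pi * y = (pi * y) *+ 2 by rewrite mulr2n; ring.
rewrite cos_mulr2n cos2sin2 => s0.
have {}s0 : sin (pi * y) = 0.
  by apply/eqP; rewrite -sqrf_eq0; apply/eqP; move: s0; rewrite mulr2n; lra.
have : y = 0.
  apply/eqP; rewrite eq_le y0 andbT leNgt; apply/negP => yp.
  suff : 0 < sin (pi * y) by rewrite s0 ltxx.
  by apply: sin_gt0_pi; rewrite mulr_gt0 ?pi_gt0//= gtr_pMr ?pi_gt0.
by rewrite /y mulrNz => /subr0_eq.
Qed.

Lemma cos_lipschitz (x y : R) : `|cos x - cos y| <= `|x - y|.
Proof.
wlog xy : x y / x < y.
  move=> H; case: (ltgtP x y) => [|yx|->]; [exact: H| |by rewrite !subrr].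
  by rewrite distrC (distrC x); exact: H.
have [c _ cE] := @mean_value R cos (fun x => - sin x) x y xy (fun w _ => is_derive_cos w).
rewrite distrC (distrC x) cE normrM normrN.
by rewrite ler_piMl// sin_max.
Qed.

(** A trigonometric polynomial, so that it extends holomorphically, whose only
    zero on the torus is the origin. *)
Definition pinch z : R := 2 - cos (2 * pi * z.1) - cos (2 * pi * z.2).

Lemma pinch_periodic : torus_periodic pinch.
Proof. by move=> z m n; rewrite /pinch /= !cosDint. Qed.

Lemma pinch_bounds z : 0 <= pinch z <= 4.
Proof.
rewrite /pinch; have := cos_le1 (2 * pi * z.1); have := cos_le1 (2 * pi * z.2).
have := cos_geN1 (2 * pi * z.1); have := cos_geN1 (2 * pi * z.2); lra.
Qed.

Lemma pinch_eq0 z : pinch z = 0 <-> exists m n : int, z = (m%:~R, n%:~R).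
Proof.
split=> [|[m [n ->]]]; last first.
  by rewrite /pinch /= (trig_int m).1 (trig_int n).1; lra.
case: z => x y; rewrite /pinch /= => p0.
have := cos_le1 (2 * pi * x); have := cos_le1 (2 * pi * y) => cy cx.
have [m ->] : exists m : int, x = m%:~R by apply: cos2pi_eq1; lra.
by have [n ->] : exists n : int, y = n%:~R by [apply: cos2pi_eq1; lra]; exists m, n.
Qed.

Lemma pinch_lipschitz z z' :
  `|pinch z - pinch z'| <= 2 * pi * (`|z.1 - z'.1| + `|z.2 - z'.2|).
Proof.
have lip (x y : R) : `|cos (2 * pi * x) - cos (2 * pi * y)| <= 2 * pi * `|x - y|.
  apply: le_trans (cos_lipschitz _ _) _.
  by rewrite -mulrBr normrM [`|2 * pi|]ger0_norm// mulr_ge0// pi_ge0.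
have := lip z.1 z'.1; have := lip z.2 z'.2; rewrite /pinch !ler_norml; lra.
Qed.

Definition speed q z : R := pinch z * pinch (z - q).

Lemma speed_periodic q : torus_periodic (speed q).
Proof. by move=> z m n; rewrite /speed addrAC !pinch_periodic. Qed.

Lemma speed_bounds q z : 0 <= speed q z <= 16.
Proof.
have /andP[a0 a4] := pinch_bounds z; have /andP[b0 b4] := pinch_bounds (z - q).
by rewrite /speed mulr_ge0//= (le_trans (ler_pM _ _ a4 b4))//; lra.
Qed.

(** Any irrational slope would do. For this one [slope ^+ 2 = 1 - 2 * slope], so
    that all powers of [slope] lie in the group generated by 1 and [slope], which
    makes the density of that group immediate. *)
Definition slope : R := Num.sqrt 2 - 1.
Definition dir : R * R := (1, slope).

Lemma slope_sqr : slope ^+ 2 = 1 - 2 * slope.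
Proof. by rewrite /slope sqrrB1 sqr_sqrtr//; ring. Qed.

Lemma slope_itv : 0 < slope < 1.
Proof.
have := slope_sqr; have : 0 <= Num.sqrt 2 :> R by rewrite sqrtr_ge0.
by rewrite /slope; nra.
Qed.

(** [4 * pi] is a Lipschitz constant of [pinch] along a line, and both factors of
    [speed] are at most 4. *)
Lemma speed_line_lipschitz q c (r r' : R) :
  `|speed q (c + r *: dir) - speed q (c + r' *: dir)| <= (32 * pi) * `|r - r'|.
Proof.
have lip c' : `|pinch (c' + r *: dir) - pinch (c' + r' *: dir)| <= 4 * pi * `|r - r'|.
  apply: le_trans (pinch_lipschitz _ _) _; rewrite /= /GRing.scale /=.
  have -> : c'.1 + r * 1 - (c'.1 + r' * 1) = r - r' by ring.
  have -> : c'.2 + r * slope - (c'.2 + r' * slope) = (r - r') * slope by ring.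
  rewrite normrM [`|slope|]ger0_norm; last by have := slope_itv; lra.
  have := normr_ge0 (r - r'); have := slope_itv; have := pi_ge0 R.
  move: `|r - r'| => d p0 s d0; have := mulr_ge0 p0 d0; nra.
have := lip c; have := lip (c - q).
rewrite /speed -![c - q + _]addrAC ![c + _ - q]addrAC.
have := pinch_bounds (c + r' *: dir); have := pinch_bounds (c - q + r *: dir).
move: (pinch (c + r *: _)) (pinch (c + r' *: _)) => a a'.
move: (pinch (c - q + r *: _)) (pinch (c - q + r' *: _)) => b b'.
move=> Hb Ha' lb la.
have -> : a * b - a' * b' = (a - a') * b + a' * (b - b') by ring.
apply: le_trans (ler_normD _ _) _; rewrite !normrM.
rewrite [`|b|]ger0_norm; last by lra. rewrite [`|a'|]ger0_norm; last by lra.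
have := normr_ge0 (a - a'); have := normr_ge0 (b - b'); nra.
Qed.

(** The linear flow of direction [dir], stopped at the origin and at [q]. *)
Definition pinched_field q (x : torus R) : R * R := speed q (repr x) *: dir.

Lemma pinched_fieldE q z : pinched_field q (torus_pi z) = speed q z *: dir.
Proof. by rewrite /pinched_field (periodic_repr z (speed_periodic q)). Qed.

Lemma is_deriveP (V : normedModType R) (f : R -> V) (t : R) l :
  is_derive t 1 f l <->
  h^-1 *: (f (h + t) - f t) @[h --> 0^'] --> l.
Proof.
have E : (fun h => h^-1 *: ((f \o shift t) (h *: 1) - f t)) =
         (fun h => h^-1 *: (f (h + t) - f t)).
  by apply/funext => h /=; rewrite /GRing.scale /= mulr1.
split=> [[df <-]|]; first by rewrite -E; exact: df.
rewrite -E => df; apply: DeriveDef; first by apply/cvg_ex; exists l.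
exact: cvg_lim.
Qed.

Lemma is_derive_pairP (f : R -> R * R) (t : R) l :
  is_derive t 1 f l <-> is_derive t 1 (fst \o f) l.1 /\ is_derive t 1 (snd \o f) l.2.
Proof.
rewrite !is_deriveP; split=> [df|[]].
  have d1 := cvg_comp _ _ df (@cvg_fst _ _ (nbhs l.1) (nbhs l.2) _).
  have d2 := cvg_comp _ _ df (@cvg_snd _ _ (nbhs l.1) (nbhs l.2) _).
  by split; [exact: d1|exact: d2].
move=> d1 d2; case: l d1 d2 => l1 l2 /= d1 d2.
exact: cvg_pair d1 d2.
Qed.

Lemma integral_curve_line q gamma : integral_curve (pinched_field q) gamma ->
  exists c (phi : R -> R), [/\ forall t, gamma t = torus_pi (c + phi t *: dir),
    phi 0 = 0 & forall t : R, is_derive t 1 phi (speed q (c + phi t *: dir))].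
Proof.
move=> [d -> dd]; pose phi t := (d t).1 - (d 0).1.
have d12 (t : R) : is_derive t 1 (fst \o d) (speed q (d t)) /\
    is_derive t 1 (snd \o d) (speed q (d t) * slope).
  have := dd t; rewrite /= pinched_fieldE => /is_derive_pairP[d1 d2].
  by split=> //; rewrite /= /GRing.scale /= mulr1 in d1.
have dE t : d t = d 0 + phi t *: dir.
  have : (d t).2 - slope * (d t).1 = (d 0).2 - slope * (d 0).1.
    apply: (@is_derive_0_is_cst R (fun t => (d t).2 - slope * (d t).1)) => s.
    have [d1 d2] := d12 s.
    have : is_derive s 1 ((snd \o d) - slope *: (fst \o d))
             (speed q (d s) * slope - slope *: speed q (d s)).
      exact: is_deriveB.
    by rewrite /GRing.scale /= [slope * _]mulrC subrr.
  move=> E; apply: injective_projections; rewrite /= /GRing.scale /= /phi; first by ring.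
  by rewrite mulrC; lra.
exists (d 0), phi; split=> [t||t]; first by rewrite /= -dE.
  by rewrite /phi subrr.
rewrite -dE; have [d1 _] := d12 t.
have : is_derive t 1 ((fst \o d) - cst (d 0).1) (speed q (d t) - 0) by exact: is_deriveB.
by rewrite subr0.
Qed.

Lemma line_integral_curve q c (phi : R -> R) :
  (forall t : R, is_derive t 1 phi (speed q (c + phi t *: dir))) ->
  integral_curve (pinched_field q) (fun t => torus_pi (c + phi t *: dir)).
Proof.
move=> dphi; exists (fun t => c + phi t *: dir) => // t.
rewrite pinched_fieldE; set v := speed _ _.
have dphit : is_derive t 1 phi v by exact: dphi.
apply/is_derive_pairP; split.
  have : is_derive t 1 (cst c.1 + phi) (0 + v) by exact: is_deriveD.
  rewrite add0r /= [v *: _]mulr1; congr is_derive.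
  by apply/funext => s /=; rewrite /GRing.scale /= mulr1.
have : is_derive t 1 (cst c.2 + slope *: phi) (0 + slope *: v).
  exact: is_deriveD.
rewrite add0r /= [v *: _]mulrC; congr is_derive.
by apply/funext => s /=; rewrite /GRing.scale /= mulrC.
Qed.

End pinched_fields.

(** * Sliding a singular point along its line *)

Section descent.
Variable R : realType.
Local Notation T := (torus R).
Implicit Types (f g : R * R -> R * R) (z : R * R).

Definition equivariant f :=
  forall z (m n : int), f (z + (m%:~R, n%:~R)) = f z + (m%:~R, n%:~R).

Definition descend f (x : T) : T := torus_pi (f (repr x)).

Lemma descendE f z : equivariant f -> descend f (torus_pi z) = torus_pi (f z).
Proof.
move=> fE; apply: (@periodic_repr R _ (fun z => torus_pi (f z))) => p m n.
by rewrite fE torus_piD.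
Qed.

Lemma descend_continuous f : continuous f -> equivariant f ->
  continuous (descend f).
Proof.
move=> fc fE; apply/quotient_continuous.
have -> : descend f \o \pi_(torus R) = @torus_pi R \o f.
  by apply/funext => z; exact: descendE.
by move=> z; apply: continuous_comp (fc z) (@torus_pi_continuous R _).
Qed.

Lemma descend_homeomorphism f g : continuous f -> continuous g ->
  equivariant f -> equivariant g -> cancel f g -> cancel g f ->
  homeomorphism (descend f).
Proof.
move=> fc gc fE gE fK gK; split; first exact: descend_continuous.
exists (descend g); first exact: descend_continuous.
by split=> x; rewrite -(torus_piK x) !descendE ?fK ?gK.
Qed.

Lemma descend_homotopic f (F : R * (R * R) -> R * R) : continuous F ->
  (forall s, equivariant (fun z => F (s, z))) ->
  (forall z, F (0, z) = f z) -> (forall z, F (1, z) = z) ->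
  homotopic R (descend f) id.
Proof.
move=> Fc FE F0 F1.
exists (fun p : R * T => torus_pi (F (p.1, repr p.2))); split=> [|x|x].
- apply: continuous_subspaceT => -[s x] U /=.
  move=> nU; have : {for (s, repr x), continuous (@torus_pi R \o F)}.
    exact: (continuous_comp (Fc _) (@torus_pi_continuous R _)).
  move=> /(_ _ nU)[[V W] [/= nV nW] VW].
  exists (V, @torus_pi R @` W) => /=.
    by split=> //; rewrite -[X in nbhs X](torus_piK x); exact: torus_pi_open.
  move=> [s' _] [/= Vs [w Ww <-]].
  have FsP : torus_periodic (fun z => torus_pi (F (s', z))).
    by move=> z m n /=; rewrite FE torus_piD.
  by rewrite /= (periodic_repr w FsP); exact: (VW (s', w)).
- by rewrite F0.
- by rewrite F1 /= torus_piK.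
Qed.

End descent.

Lemma near_dist_lt (R : realType) (V : normedModType R) (z : V) (e : R) :
  0 < e -> \forall w \near z, `|z - w| < e.
Proof.
by move=> e0; apply/nbhs_ballP; exists e => // w; rewrite -ball_normE.
Qed.

Lemma continuous_line_map (R : realType) (U : topologicalType)
    (f : U -> R * R) (r : U -> R) (d : R * R) (x : U) :
  {for x, continuous f} -> {for x, continuous r} ->
  {for x, continuous (fun x => f x + r x *: d)}.
Proof. by move=> fc rc; exact: (continuousD fc (continuousZr_tmp rc)). Qed.

Section slide.
Variable R : realType.
Variable a : R.
(* [4 * pi] is a Lipschitz constant of [pinch] for the sup norm, so that [a * pinch]
   is a contraction of ratio [1 / 2]. *)
Hypothesis a_small : `|a| * (4 * pi) <= 2^-1.
Implicit Types (q z c : R * R).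
Local Notation dir := (@dir R).

(** Each point is pushed along its own line, by a length that vanishes at the
    origin: lines are preserved, the origin is fixed and [q] moves by
    [a * pinch q]. *)
Definition slide z := z + (a * pinch z) *: dir.

Lemma norm_dirZ (r : R) : `|r *: dir| = `|r|.
Proof.
rewrite prod_normE /= /GRing.scale /= mulr1 normrM max_l//.
by rewrite ler_piMr// ger0_norm; have := slope_itv R; lra.
Qed.

Lemma pinch_contraction z z' : `|a * pinch z - a * pinch z'| <= 2^-1 * `|z - z'|.
Proof.
rewrite -mulrBr normrM.
have [n1 n2] : `|z.1 - z'.1| <= `|z - z'| /\ `|z.2 - z'.2| <= `|z - z'|.
  by rewrite prod_normE !le_max !lexx orbT.
have := pinch_lipschitz z z'; move: a_small n1 n2.
have := normr_ge0 a; have := normr_ge0 (z - z'); have := @pi_gt0 R.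
move: `|a| `|z - z'| `|pinch z - _| `|z.1 - _| `|z.2 - _| => A d P d1 d2.
move=> p0 d0 A0 As h1 h2 HP.
have {}HP : P <= 4 * pi * d by apply: le_trans HP _; nra.
apply: (@le_trans _ _ (A * (4 * pi * d))); first exact: ler_wpM2l.
by rewrite mulrA ler_wpM2r.
Qed.

Lemma slide_equivariant : equivariant slide.
Proof. by move=> z m n; rewrite /slide pinch_periodic addrAC. Qed.

Lemma slide_expanding z z' : `|z - z'| <= 2 * `|slide z - slide z'|.
Proof.
have -> : slide z - slide z' = (z - z') + (a * pinch z - a * pinch z') *: dir.
  by rewrite /slide scalerBl; apply: injective_projections => /=; ring.
have := lerB_dist (z - z') (- ((a * pinch z - a * pinch z') *: dir)).
rewrite opprK normrN norm_dirZ; have := pinch_contraction z z'; lra.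
Qed.

Lemma slide_inj : injective slide.
Proof.
move=> z z' E; have := slide_expanding z z'.
by rewrite E subrr normr0 mulr0 normr_le0 subr_eq0 => /eqP.
Qed.

Lemma pinchM_small z : `|a * pinch z| <= 1.
Proof.
rewrite normrM [`|pinch z|]ger0_norm; last by have := pinch_bounds z; lra.
have := pinch_bounds z; have := a_small; have := pi_ge2 R; have := normr_ge0 a.
by move: `|a| (pinch z) => A P; nra.
Qed.

Lemma pinch_continuous : continuous (@pinch R).
Proof.
move=> z; apply/cvgrPdist_lt => e e0.
have p4 : 0 < 4 * pi :> R by rewrite mulr_gt0// pi_gt0.
have dz := @near_dist_lt R (R * R)%type z (e / (4 * pi)) (divr_gt0 e0 p4).
near=> w; apply: (@le_lt_trans _ _ (4 * pi * `|z - w|)).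
  have [n1 n2] : `|z.1 - w.1| <= `|z - w| /\ `|z.2 - w.2| <= `|z - w|.
    by rewrite prod_normE !le_max !lexx orbT.
  by apply: le_trans (pinch_lipschitz _ _) _; have := @pi_ge0 R; nra.
rewrite mulrC -ltr_pdivlMr//.
by near: w; exact: dz.
Unshelve. all: by end_near. Qed.

Lemma slide_continuous : continuous slide.
Proof.
move=> z; apply: (@continuous_line_map _ _ id (fun z => a * pinch z)).
  exact: cvg_id.
by apply: (@cvgM R _ (nbhs z) _ (fun=> a)); [exact: cvg_cst|exact: pinch_continuous].
Qed.

Lemma line_continuous c : continuous (fun r : R => c + r *: dir).
Proof.
move=> r; apply: (@continuous_line_map _ _ (fun=> c) id); first exact: cvg_cst.
exact: cvg_id.
Qed.

Definition slide_line c (r : R) := r + a * pinch (c + r *: dir).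

Lemma slide_lineE c r : slide (c + r *: dir) = c + slide_line c r *: dir.
Proof. by rewrite /slide /slide_line scalerDl addrA. Qed.

Lemma slide_line_mono c : {mono slide_line c : r s / r <= s}.
Proof.
apply: le_mono => r s rs.
have := pinch_contraction (c + r *: dir) (c + s *: dir).
have -> : c + r *: dir - (c + s *: dir) = (r - s) *: dir.
  by rewrite scalerBl; apply: injective_projections => /=; ring.
by rewrite norm_dirZ (distrC r s) (@gtr0_norm _ (s - r)) ?subr_gt0// /slide_line ler_norml; lra.
Qed.

Lemma slide_line_onto c : range (slide_line c) = setT.
Proof.
apply/seteqP; split=> // t _.
have [|||r _ <-] := @intermediate_value R (slide_line c) (t - 1) (t + 1) t; last by exists r.
- move=> r; apply: (@cvgD R R _ (nbhs r) _ id (fun r => a * pinch (c + r *: dir))).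
    exact: cvg_id.
  apply: (@cvgM R _ (nbhs r) _ (fun=> a)); first exact: cvg_cst.
  have lc := @line_continuous c r.
  have pc := @pinch_continuous (c + r *: dir).
  exact: (cvg_comp _ _ lc pc).
- lra.
- rewrite /slide_line; have := pinchM_small (c + (t - 1) *: dir).
  by have := pinchM_small (c + (t + 1) *: dir); rewrite !ler_norml; lra.
Qed.

Lemma slide_homeomorphism : homeomorphism (descend slide).
Proof.
have /choice[g gK] z : exists w, slide w = z.
  have [r _ rE] : range (slide_line z) 0 by rewrite slide_line_onto.
  by exists (z + r *: dir); rewrite slide_lineE rE scale0r addr0.
apply: (descend_homeomorphism (g := g)) => //.
- exact: slide_continuous.
- move=> z; apply/cvgrPdist_lt => e e0.
  have dz := @near_dist_lt R (R * R)%type z (e / 2) (divr_gt0 e0 (@ltr0Sn R 1)).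
  near=> w.
  apply: le_lt_trans (slide_expanding _ _) _; rewrite !gK mulrC -ltr_pdivlMr//.
  by near: w; exact: dz.
- exact: slide_equivariant.
- by move=> z m n; apply: slide_inj; rewrite slide_equivariant !gK.
- by move=> z; apply: slide_inj; rewrite gK.
Unshelve. all: by end_near. Qed.

Lemma slide_homotopic : homotopic R (descend slide) id.
Proof.
apply: (@descend_homotopic R slide
  (fun p => p.2 + ((1 - p.1) * (a * pinch p.2)) *: dir)).
- move=> p.
  have c1 : {for p, continuous (fun p : R * (R * R) => 1 - p.1)}.
    by apply: (@cvgB R R _ (nbhs p) _ (fun=> 1) fst); [exact: cvg_cst|exact: cvg_fst].
  have c2 : {for p, continuous (fun p : R * (R * R) => pinch p.2)}.
    exact: (@cvg_comp _ _ _ snd (@pinch R) _ _ _ cvg_snd (@pinch_continuous p.2)).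
  have c3 : {for p, continuous (fun p : R * (R * R) => (1 - p.1) * (a * pinch p.2))}.
    apply: cvgM; first exact: c1.
    by apply: cvgM; [exact: cvg_cst|exact: c2].
  have c0 : {for p, continuous (fun p : R * (R * R) => p.2)} by exact: cvg_snd.
  move: (@continuous_line_map R _ _ _ dir p c0 c3); exact.
- by move=> s z m n /=; rewrite pinch_periodic addrAC.
- by move=> z /=; rewrite subr0 mul1r.
- by move=> z /=; rewrite subrr mul0r scale0r addr0.
Qed.

Lemma slide_pinch z : pinch z = 0 <-> pinch (slide z) = 0.
Proof.
have fixed w : pinch w = 0 -> slide w = w.
  by move=> p0; rewrite /slide p0 mulr0 scale0r addr0.
split=> [p0|sz0]; first by rewrite fixed.
have e : slide z = z by apply: slide_inj; rewrite fixed.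
by rewrite -e.
Qed.

(** The slide commutes with integer translations, fixes the origin and sends [q]
    to [q + (a * pinch q) *: dir]; injectivity gives the converse. *)
Lemma slide_speed q z : 
  speed q z = 0 <-> speed (q + (a * pinch q) *: dir) (slide z) = 0.
Proof.
set q' := q + _.
have pq w : pinch (w - q) = 0 <-> pinch (slide w - q') = 0.
  rewrite !pinch_eq0; split=> -[m [n E]]; exists m, n.
    have -> : w = q + (m%:~R, n%:~R) by rewrite -E subrKC.
    by rewrite slide_equivariant /slide addrAC subrr add0r.
  have -> : w = q + (m%:~R, n%:~R).
    by apply: slide_inj; rewrite slide_equivariant -E subrKC.
  by rewrite addrAC subrr add0r.
rewrite /speed; split=> /eqP; rewrite mulf_eq0 => /orP[] /eqP.
- by move=> /(slide_pinch z).1 ->; rewrite mul0r.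
- by move=> /(pq z).1 ->; rewrite mulr0.
- by move=> /(slide_pinch z).2 ->; rewrite mul0r.
- by move=> /(pq z).2 ->; rewrite mulr0.
Qed.

(** The two fields and the slide restrict to each line of direction [dir], where
    [time_change] applies. *)
Lemma slide_maps_orbits q :
  maps_orbits (pinched_field q) (pinched_field (q + (a * pinch q) *: dir))
    (descend slide).
Proof.
set q' := q + _ => gamma /integral_curve_line[c [phi [gE phi0 dphi]]].
have HE t : descend slide (gamma t) = torus_pi (c + slide_line c (phi t) *: dir).
  by rewrite gE descendE ?slide_lineE//; exact: slide_equivariant.
pose h r := speed q (c + r *: dir); pose k r := speed q' (c + r *: dir).
have K0 : 0 < 32 * pi :> R by rewrite mulr_gt0// pi_gt0.
have hK := @speed_line_lipschitz R q c; have kK := @speed_line_lipschitz R q' c.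
have hM r := speed_bounds q (c + r *: dir).
have kM r := speed_bounds q' (c + r *: dir).
have hk r : h r = 0 <-> k (slide_line c r) = 0.
  by rewrite /k -slide_lineE; exact: slide_speed.
have [h0|h0] := eqVneq (h 0) 0.
  have phiE := rest_point_unique hK dphi h0 phi0.
  exists (descend slide \o gamma); split; last first.
    exists id; split=> //.
    by apply/seteqP; split=> // s _; exists s.
  have -> : descend slide \o gamma =
      fun t => torus_pi (c + cst (slide_line c 0) t *: dir).
    by apply/funext => t /=; rewrite HE phiE.
  apply: line_integral_curve => t /=.
  by rewrite -/(k _) (hk 0).1//; exact: is_derive_cst.
have {}h0 : 0 < h (phi 0) by rewrite phi0 lt_neqAle eq_sym h0 (andP (hM 0)).1.
have [D [s [dD sm so sE]]] := time_change K0 hK kK hM kM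
  (slide_line_mono c) (slide_line_onto c) hk dphi h0.
exists (fun t => torus_pi (c + D t *: dir)); split.
  exact: line_integral_curve.
by exists s; split=> // t; rewrite HE sE.
Qed.

End slide.

(** As long as [q] stays away from the origin, it can be moved along its line
    without changing the class of the field. *)
Lemma slide_orbitally_equivalent (R : realType) (q : R * R) : pinch q != 0 ->
  \forall t \near 0,
    orbitally_equivalent (pinched_field q) (pinched_field (q + t *: dir R)).
Proof.
move=> pq.
have p4 : 0 < 4 * pi :> R by rewrite mulr_gt0// pi_gt0.
apply/nbhs_ballP; exists (2^-1 / (4 * pi) * `|pinch q|) => /=.
  by rewrite mulr_gt0 ?normr_gt0// divr_gt0// invr_gt0.
move=> t; rewrite -ball_normE /= sub0r normrN => t_small.
pose a := t / pinch q.
have -> : t = a * pinch q by rewrite /a divfK.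
have a_small : `|a| * (4 * pi) <= 2^-1.
  rewrite -ler_pdivlMr// /a normrM normfV ler_pdivrMr ?normr_gt0//.
  exact: ltW.
exists (descend (slide a)); split.
- exact: slide_homeomorphism.
- exact: slide_homotopic.
- exact: slide_maps_orbits.
Qed.

(** * Holomorphic extension of the fields *)

Section complexified_fields.
Variable K : numFieldType.
Variables (e : K -> K) (k C r : K).
Hypothesis eD : forall z w, e (z + w) = e z * e w.
Hypothesis C0 : 0 < C.
Hypothesis r0 : 0 < r.
Hypothesis e_linear : forall h, `|h| <= r -> `|e h - 1 - k * h| <= C * `|h| ^+ 2.

(** The addition formula reduces differentiability to the origin. *)
Lemma character_derivable (z : K) : derivable e z 1.
Proof.
apply/cvg_ex; exists (e z * k).
apply/cvgrPdist_le => d d0.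
have eC0 : 0 < `|e z| * C + 1 by rewrite ltr_wpDl// mulr_ge0// ltW.
near=> h.
have h0 : h != 0 by near: h; exact: nbhs_dnbhs_neq.
have -> : e z * k - h^-1 *: ((e \o shift z) (h *: 1) - e z) =
    - (e z * (h^-1 * (e h - 1 - k * h))).
  rewrite /= /GRing.scale /= mulr1 addrC eD.
  by field.
rewrite normrN !normrM normfV mulrCA ler_pdivrMl ?normr_gt0//.
have hr : `|h| <= r by near: h; exact: dnbhs0_le.
apply: le_trans (ler_wpM2l (normr_ge0 _) (e_linear hr)) _.
rewrite expr2 !mulrA [leRHS]mulrC ler_wpM2r//.
have hd : `|h| <= d / (`|e z| * C + 1) by near: h; apply: dnbhs0_le; rewrite divr_gt0.
move: hd; rewrite ler_pdivlMr//; apply: le_trans.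
by rewrite mulrDr mulr1 mulrC lerDl.
Unshelve. all: by end_near. Qed.

Definition cpinch (p : K * K) : K :=
  2 - (e p.1 + e (- p.1)) / 2 - (e p.2 + e (- p.2)) / 2.

Lemma cpinch_differentiable (p : K * K) : differentiable cpinch p.
Proof.
have de (f : K * K -> K) : differentiable f p -> differentiable (e \o f) p.
  move=> df; apply: differentiable_comp => //.
  exact/derivable1_diffP/character_derivable.
have d1 : differentiable (fst : K * K -> K) p.
  by apply: (@linear_differentiable _ (K * K)%type K fst) => q; exact: cvg_fst.
have d2 : differentiable (snd : K * K -> K) p.
  by apply: (@linear_differentiable _ (K * K)%type K snd) => q; exact: cvg_snd.
have -> : cpinch = cst 2 - 2^-1 *: ((e \o fst) + (e \o (- (fst : K * K -> K))))
    - 2^-1 *: ((e \o snd) + (e \o (- (snd : K * K -> K)))).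
  by apply/funext => q; rewrite /cpinch /= !fctE /= /GRing.scale /= ![2^-1 * _]mulrC.
apply: differentiableB; first apply: differentiableB; first exact: differentiable_cst.
  by apply: differentiableZ; apply: differentiableD; apply: de => //; exact: differentiableN.
by apply: differentiableZ; apply: differentiableD; apply: de => //; exact: differentiableN.
Qed.

Definition cspeed (q p : K * K) : K := cpinch p * cpinch (p - q).

Lemma cspeed_differentiable (a : K) (q p : K * K) :
  differentiable (fun p : K * K => (cspeed q p, cspeed q p * a)) p.
Proof.
have ds : differentiable (cspeed q) p.
  rewrite (_ : cspeed q = cpinch * (cpinch \o ((id : K * K -> K * K) - cst q)))//.
  apply: differentiableM; first exact: cpinch_differentiable.
  apply: differentiable_comp; last exact: cpinch_differentiable.
  by apply: differentiableB.
apply: differentiable_pair => //.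
rewrite (_ : (fun p => _) = cspeed q * cst a)//.
by apply: differentiableM.
Qed.

End complexified_fields.
Section complexified_bounds.
Variable K : numFieldType.
Variables (e : K -> K) (B : K).
Hypothesis eD : forall z w, e (z + w) = e z * e w.

Definition exp_bounded (p : K * K) :=
  [/\ `|e p.1| <= B, `|e (- p.1)| <= B, `|e p.2| <= B & `|e (- p.2)| <= B].

Lemma cpinch_bound p : exp_bounded p -> `|cpinch e p| <= 2 + B + B.
Proof.
have half (x y : K) : `|x| <= B -> `|y| <= B -> `|(x + y) / 2| <= B.
  move=> xB yB; rewrite normrM normfV (@ger0_norm _ 2)// ler_pdivrMr//.
  by rewrite mulr_natr mulr2n (le_trans (ler_normD _ _))// lerD.
move=> [p1 p1' p2 p2']; rewrite /cpinch.
apply: le_trans (ler_normB _ _) _; rewrite lerD ?half//.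
apply: le_trans (ler_normB _ _) _; rewrite lerD ?half//.
by rewrite ger0_norm.
Qed.

Lemma cspeed_bound q p : exp_bounded p -> exp_bounded (p - q) ->
  `|cspeed e q p| <= (2 + B + B) * (2 + B + B).
Proof. by move=> tp tq; rewrite normrM ler_pM// cpinch_bound. Qed.

Lemma cspeed_close (b b' : K) p : exp_bounded p ->
  `|cspeed e (0, b) p - cspeed e (0, b') p| <=
    (2 + B + B) * (B * ((`|e b - e b'| + `|e (- b) - e (- b')|) / 2)).
Proof.
move=> tp; rewrite /cspeed -mulrBr normrM ler_pM// ?cpinch_bound//.
case: tp => _ _ p2 p2'; rewrite /cpinch /= !subr0 (opprB p.2 b) (opprB p.2 b') !eD.
have -> : 2 - (e p.1 + e (- p.1)) / 2 - (e p.2 * e (- b) + e b * e (- p.2)) / 2 -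
    (2 - (e p.1 + e (- p.1)) / 2 - (e p.2 * e (- b') + e b' * e (- p.2)) / 2) =
    - ((e (- p.2) * (e b - e b') + e p.2 * (e (- b) - e (- b'))) / 2).
  by ring.
rewrite normrN [leRHS]mulrA normrM normfV (@ger0_norm _ 2)// ler_wpM2r ?invr_ge0//.
rewrite [leRHS]mulrDr (le_trans (ler_normD _ _))//.
by rewrite lerD// normrM ler_wpM2r.
Qed.
End complexified_bounds.

Section complex_exponential.
Variable R : realType.
Local Notation C := R[i].
Local Open Scope complex_scope.
Local Notation Re := complex.Re.
Local Notation Im := complex.Im.

(** The function [exp (2 * pi * i * z)], whose addition formula and linear
    approximation at 0 give holomorphy. *)
Definition cexp (z : C) : C :=
  (expR (- (2 * pi * Im z)) * cos (2 * pi * Re z)) +i*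
  (expR (- (2 * pi * Im z)) * sin (2 * pi * Re z)).

Lemma cexpD z w : cexp (z + w) = cexp z * cexp w.
Proof.
case: z w => [a b] [c d]; rewrite /cexp /=.
rewrite !mulrDr opprD expRD cosD sinD.
by apply/eqP; rewrite eq_complex /=; apply/andP; split; apply/eqP; ring.
Qed.

Lemma cexp_real (x : R) : cexp x%:C = cos (2 * pi * x) +i* sin (2 * pi * x).
Proof. by rewrite /cexp /= mulr0 oppr0 expR0 !mul1r. Qed.

Lemma cexp_int (m : int) : cexp m%:~R = 1.
Proof.
have -> : m%:~R = (m%:~R : R)%:C by rewrite rmorph_int.
by rewrite cexp_real (trig_int R m).1 (trig_int R m).2.
Qed.

Lemma Im_int (m : int) : Im (m%:~R : C) = 0.
Proof. by rewrite -(rmorph_int (real_complex R)). Qed.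

Lemma ler_norm_complex (a b c : R) : `|a| <= c -> `|b| <= c -> `|a +i* b| <= (c *+ 2)%:C.
Proof.
move=> ac bc; rewrite normc_def lecR /=.
have c0 : 0 <= c by apply: le_trans ac.
rewrite -[c *+ 2]ger0_norm ?mulrn_wge0// -sqrtr_sqr ler_wsqrtr//.
by move: ac bc; rewrite !ler_norml mulr2n => ac bc; nra.
Qed.

Lemma norm_Re_Im (z : C) : (`|Re z|)%:C <= `|z| /\ (`|Im z|)%:C <= `|z|.
Proof.
by rewrite normc_def !lecR; split; rewrite -sqrtr_sqr ler_wsqrtr// ?lerDl ?lerDr sqr_ge0.
Qed.

Lemma norm_cexp (z : C) : `|cexp z| = (expR (- (2 * pi * Im z)))%:C.
Proof.
by rewrite normc_def /= !exprMn -mulrDr cos2Dsin2 mulr1 sqrtr_sqr ger0_norm// expR_ge0.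
Qed.

(** From [1 + y <= expR y] and [1 - y <= expR (- y)]. *)
Lemma expR_linear (y : R) : `|y| <= 1 / 2 -> `|expR y - 1 - y| <= 2 * y ^+ 2.
Proof.
rewrite ler_norml => y2.
have e1 := expR_ge1Dx y; rewrite ger0_norm; last by lra.
have e2 : (1 - y) * expR y <= 1.
  by rewrite -ler_pdivlMr ?expR_gt0// mul1r -expRN expR_ge1Dx.
have y3 : 0 <= y ^+ 2 * (1 - 2 * y) by rewrite mulr_ge0 ?sqr_ge0//; lra.
have : (1 - y) * expR y <= (1 - y) * (1 + y + 2 * y ^+ 2).
  by apply: le_trans e2 _; lra.
by rewrite ler_pM2l; lra.
Qed.

Lemma sin_lipschitz (x y : R) : `|sin x - sin y| <= `|x - y|.
Proof.
rewrite -!cosBpihalf; apply: le_trans (cos_lipschitz _ _) _.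
by rewrite opprB addrA addrNK.
Qed.

Lemma cos_linear (x : R) : `|cos x - 1| <= x ^+ 2.
Proof.
have -> : cos x - 1 = - (2 * sin (x / 2) ^+ 2).
  have -> : x = (x / 2) *+ 2 by rewrite -mulr_natr divfK.
  rewrite cos_mulr2n cos2sin2 -[(x / 2) *+ 2]mulr_natr mulfK// mulr2n; ring.
have := sin_lipschitz (x / 2) 0; rewrite sin0 !subr0 => s.
rewrite normrN normrM normrX ger0_norm//.
have : `|sin (x / 2)| ^+ 2 <= `|x / 2| ^+ 2 by rewrite ler_sqr ?nnegrE.
rewrite [leRHS]real_normK ?num_real// expr_div_n; have := sqr_ge0 x; lra.
Qed.

Lemma sin_linear (x : R) : `|sin x - x| <= x ^+ 2.
Proof.
wlog x0 : x / 0 < x.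
  move=> H; case: (ltgtP 0 x) => [|x0|<-]; first exact: H.
    by have := H (- x); rewrite oppr_gt0 sinN sqrrN -opprD normrN => /(_ x0).
  by rewrite sin0 subrr normr0 sqr_ge0.
have [c /andP[c0 cx]] := @mean_value R (fun t => sin t - t) (fun t => cos t - 1) 0 x x0
  (fun t _ => is_deriveB (is_derive_sin t) (is_derive_id t 1)).
rewrite sin0 !subr0 => ->; rewrite normrM (gtr0_norm x0) expr2 ler_wpM2r ?(ltW x0)//.
have := cos_lipschitz c 0; rewrite cos0 subr0 (gtr0_norm c0) => /le_trans; apply.
exact: ltW.
Qed.

(** With [X] and [Y] the real and imaginary parts of [2 * pi * h], the error terms
    come from the first-order estimates for [expR (- Y)], [cos X] and [sin X]. The
    radius ensures that [X] and [Y] are at most [1 / 2], as [expR_linear] asks. *)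
Lemma cexp_linear (h : C) : `|h| <= ((1 / (4 * pi)) : R)%:C ->
  `|cexp h - 1 - (0 +i* (2 * pi)) * h| <= ((24 * pi ^+ 2) : R)%:C * `|h| ^+ 2.
Proof.
move=> hr; have [] := norm_Re_Im h => /le_trans/(_ hr) + /le_trans/(_ hr).
rewrite !lecR {hr}; case: h => a b /= ar br.
have p0 := @pi_gt0 R.
pose X := 2 * pi * a; pose Y := 2 * pi * b.
have small (t : R) : `|t| <= 1 / (4 * pi) -> `|2 * pi * t| <= 1 / 2.
  rewrite normrM [`|2 * pi|]gtr0_norm ?mulr_gt0// ler_pdivlMr ?mulr_gt0//; lra.
have X2 : `|X| <= 1 / 2 by exact: small.
have Y2 : `|- Y| <= 1 / 2 by rewrite normrN; exact: small.
have hE : `|a +i* b| ^+ 2 = (a ^+ 2 + b ^+ 2)%:C.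
  by rewrite normc_def /= -rmorphXn /= sqr_sqrtr// addr_ge0 ?sqr_ge0.
have -> : cexp (a +i* b) - 1 - (0 +i* (2 * pi)) * (a +i* b) =
    (expR (- Y) * cos X - 1 + Y) +i* (expR (- Y) * sin X - X).
  rewrite /cexp /=; apply/eqP; rewrite eq_complex /= /X /Y.
  by apply/andP; split; apply/eqP; ring.
rewrite hE -rmorphM /=.
have -> : 24 * pi ^+ 2 * (a ^+ 2 + b ^+ 2) = (3 * (X ^+ 2 + Y ^+ 2)) *+ 2.
  by rewrite mulr2n /X /Y; ring.
have E := expR_linear Y2; have c := cos_linear X; have s := sin_linear X.
move: E c s X2 Y2; rewrite sqrrN normrN.
move: (expR (- Y)) (cos X) (sin X) => e c s.
clearbody X Y => E cX sX X2 Y2.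
have e2 : 0 <= e <= 2 by move: E Y2; rewrite !ler_norml; nra.
have XY : `|X| * `|Y| <= (X ^+ 2 + Y ^+ 2) / 2.
  have := sqr_ge0 (`|X| - `|Y|); rewrite -[X ^+ 2]real_normK ?num_real//.
  by rewrite -[Y ^+ 2]real_normK ?num_real//; nra.
have [X0 Y0] : 0 <= X ^+ 2 /\ 0 <= Y ^+ 2 by rewrite !sqr_ge0.
apply: ler_norm_complex.
- have -> : e * c - 1 + Y = (e - 1 - - Y) + e * (c - 1) by ring.
  apply: le_trans (ler_normD _ _) _; rewrite normrM (@ger0_norm _ e); last by lra.
  have := normr_ge0 (c - 1); nra.
- have -> : e * s - X = e * (s - X) + (e - 1) * X by ring.
  apply: le_trans (ler_normD _ _) _; rewrite !normrM (@ger0_norm _ e); last by lra.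
  have e1 : `|e - 1| <= 2 * `|Y|.
    rewrite -real_normK ?num_real// in E.
    have := ler_normD (e - 1 - - Y) (- Y); rewrite subrK normrN => /le_trans; apply.
    by have := normr_ge0 Y; nra.
  have := normr_ge0 (s - X); have := normr_ge0 X; nra.
Qed.
End complex_exponential.

Lemma open_setX_norm (K : numFieldType) (P : set K) :
  (forall w, P w -> exists2 e, 0 < e & forall v, `|w - v| < e -> P v) ->
  open [set p : K * K | P p.1 /\ P p.2].
Proof.
move=> Pe; have oP : open P.
  rewrite openE => w /Pe[e e0 eP]; apply/nbhs_ballP; exists e => //.
apply: openI.
- exact: (open_comp (f := fst) (fun p _ => cvg_fst) oP).
- exact: (open_comp (f := snd) (fun p _ => cvg_snd) oP).
Qed.

Section analytic_pinched_fields.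
Variable R : realType.
Local Notation C := R[i].
Local Open Scope complex_scope.
Implicit Types (q : R * R) (z p : C * C).

Definition cfield (q : C * C) (x : torus C) : C * C :=
  (cspeed (@cexp R) q (repr x), cspeed (@cexp R) q (repr x) * (slope R)%:C).

Lemma cspeed_periodic (q : C * C) : torus_periodic (cspeed (@cexp R) q).
Proof.
have cE (w : C) (m : int) : cexp (w + m%:~R) = cexp w.
  by rewrite cexpD cexp_int mulr1.
have pP : torus_periodic (cpinch (@cexp R)).
  by move=> p m n; rewrite /cpinch /= !opprD -!mulrNz !cE.
by move=> p m n; rewrite /cspeed addrAC !pP.
Qed.

Lemma cfieldE (q : C * C) p : cfield q (torus_pi p) =
  (cspeed (@cexp R) q p, cspeed (@cexp R) q p * (slope R)%:C).
Proof. by rewrite /cfield !(periodic_repr p (cspeed_periodic q)). Qed.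

(** The functions at hand are entire, but bounded only where the imaginary parts
    are. *)
Definition strip : set (torus C) :=
  [set x | `|complex.Im (repr x).1| < 1 /\ `|complex.Im (repr x).2| < 1].

Lemma stripE p : strip (torus_pi p) <->
  `|complex.Im p.1| < 1 /\ `|complex.Im p.2| < 1.
Proof.
have P : torus_periodic (fun p : C * C => `|complex.Im p.1| < 1 /\ `|complex.Im p.2| < 1).
  by move=> z m n /=; rewrite !raddfD /= !Im_int !addr0.
by rewrite /strip /= (periodic_repr p P).
Qed.

Lemma cpinch_complexify q : cpinch (@cexp R) (complexify q) = (pinch q)%:C.
Proof.
have half (x : R) : (cexp x%:C + cexp (- x%:C)) / 2 = (cos (2 * pi * x))%:C.
  rewrite -rmorphN /= !cexp_real mulrN cosN sinN.
  have -> : cos (2 * pi * x) +i* sin (2 * pi * x) +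
      (cos (2 * pi * x) +i* - sin (2 * pi * x)) = (cos (2 * pi * x))%:C * 2.
    by apply/eqP; rewrite eq_complex /=; apply/andP; split; apply/eqP; ring.
  by rewrite mulfK// pnatr_eq0.
by rewrite /cpinch /pinch !half !rmorphB /= rmorph_nat.
Qed.

Lemma cfield_extends q : extends_field (cfield (complexify q)) (pinched_field q).
Proof.
move=> x; rewrite /torus_incl cfieldE /pinched_field /cspeed.
have -> : complexify (repr x) - complexify q = complexify (repr x - q).
  by rewrite /complexify /= !rmorphB.
by rewrite !cpinch_complexify /complexify /speed /= /GRing.scale /= mulr1 !rmorphM.
Qed.

Lemma strip_nbhd : complex_nbhd strip.
Proof.
split; last first.
  move=> _ [x _ <-]; apply/stripE => /=.
  by rewrite normr0.
apply/open_torus.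
have -> : @torus_pi C @^-1` strip =
    [set p : C * C | `|complex.Im p.1| < 1 /\ `|complex.Im p.2| < 1].
  by apply/seteqP; split=> p /=; rewrite stripE.
apply: (@open_setX_norm C [set w | `|complex.Im w| < 1]) => w /= w1.
exists (1 - `|complex.Im w|)%:C => [|v wv]; first by rewrite ltcR subr_gt0.
have := le_lt_trans (norm_Re_Im (w - v)).2 wv.
rewrite ltcR raddfB /= => wv'.
rewrite -(subKr (complex.Im w) (complex.Im v)).
by apply: le_lt_trans (ler_normB _ _) _; lra.
Qed.

(** The supremum of the norms of [exp (2 * pi * i * z)] and of its inverse on the
    strip. *)
Definition strip_bound : R := expR (2 * pi).

Lemma strip_exp_bounded p : `|complex.Im p.1| < 1 /\ `|complex.Im p.2| < 1 ->
  exp_bounded (@cexp R) strip_bound%:C p.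
Proof.
have bd (w : C) : `|complex.Im w| < 1 -> `|cexp w| <= strip_bound%:C.
  rewrite norm_cexp lecR ler_expR ltr_norml => w1.
  by have := @pi_gt0 R; nra.
by move=> [p1 p2]; split; apply: bd; rewrite // raddfN normrN.
Qed.

Lemma norm_pair_le (a b c : C) : `|a| <= c -> `|b| <= c -> `|(a, b)| <= c.
Proof. by move=> ac bc; rewrite prod_normE /= /Num.max; case: ifP. Qed.

Lemma cfield_norm_le (a c : C) : `|a| <= c -> `|(a, a * (slope R)%:C)| <= c.
Proof.
move=> ac; apply: norm_pair_le => //; apply: le_trans ac.
rewrite normrM ler_piMr// normc_def /= expr0n addr0 sqrtr_sqr lecR.
by have s := slope_itv R; rewrite ger0_norm; lra.
Qed.

Lemma cfield_holomorphic q : bounded_holomorphic strip (cfield (complexify q)).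
Proof.
split=> [z _|].
  rewrite /torus_differentiable.
  have -> : cfield (complexify q) \o torus_pi (K := C) =
      fun p => (cspeed (@cexp R) (complexify q) p, cspeed (@cexp R) (complexify q) p * (slope R)%:C).
    by apply/funext => p; exact: cfieldE.
  apply: cspeed_differentiable (@cexpD R) _ _ (@cexp_linear R) _ _ _.
  - by rewrite ltcR mulr_gt0// exprn_gt0// pi_gt0.
  - by rewrite ltcR divr_gt0// mulr_gt0// pi_gt0.
exists ((2 + strip_bound%:C + strip_bound%:C) * (2 + strip_bound%:C + strip_bound%:C)) => x Wx.
rewrite -(torus_piK x) in Wx *; set p := repr x in Wx *.
move/stripE in Wx; rewrite cfieldE; apply: cfield_norm_le.
apply: cspeed_bound; apply: strip_exp_bounded => //.
by rewrite /= !raddfB /= !subr0.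
Qed.

Lemma pinched_field_analytic q : real_analytic (pinched_field q).
Proof.
exists strip, (cfield (complexify q)); split.
- exact: strip_nbhd.
- exact: cfield_holomorphic.
- exact: cfield_extends.
Qed.

Definition pinched (b : R) : analytic_field R :=
  AnalyticField (pinched_field_analytic (0, b)).

(** All the fields of the family extend to the same strip, so that continuity for
    the inductive limit topology follows from uniform convergence on that strip. *)
Lemma pinched_continuous (U : set (analytic_field R)) :
  open U -> open (pinched @^-1` U).
Proof.
move=> oU; rewrite openE => b0 /= Ub0.
have [e e0 eU] := oU strip strip_nbhd _ (pinched b0) (cfield_holomorphic (0, b0))
  (@cfield_extends (0, b0)) Ub0.
pose A := (2 + strip_bound + strip_bound) * (strip_bound * (4 * pi)).
have p0 := @pi_gt0 R.
have s0 : 0 < strip_bound by exact: expR_gt0.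
have A0 : 0 < A by rewrite !mulr_gt0// !addr_gt0.
apply/nbhs_ballP; exists (e / A) => /=; first by rewrite divr_gt0.
move=> b; rewrite -ball_normE /= => bb.
apply: (eU _ (pinched b) (cfield_holomorphic (0, b)) (@cfield_extends (0, b))) => x Wx.
rewrite -(torus_piK x) in Wx *; set p := repr x in Wx *.
move/stripE in Wx; rewrite !cfieldE.
set f := cspeed _ _ _; set g := cspeed _ _ _.
have -> : (f, f * (slope R)%:C) - (g, g * (slope R)%:C) = (f - g, (f - g) * (slope R)%:C).
  by rewrite mulrBl.
have {bb} : (A * `|b0 - b|)%:C < e%:C :> C by rewrite ltcR mulrC -ltr_pdivlMr.
apply: le_lt_trans; apply: cfield_norm_le.
have le1 (s t : R) : `|cexp s%:C - cexp t%:C| <= (4 * pi * `|s - t|)%:C.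
  rewrite !cexp_real.
  have -> : 4 * pi * `|s - t| = (2 * pi * `|s - t|) *+ 2 by rewrite mulr2n; ring.
  have E : 2 * pi * `|s - t| = `|2 * pi * s - 2 * pi * t|.
    by rewrite -mulrBr normrM [`|2 * pi|]gtr0_norm// mulr_gt0.
  by apply: ler_norm_complex; rewrite E; [exact: cos_lipschitz|exact: sin_lipschitz].
have := cspeed_close (@cexpD R) b0%:C b%:C (strip_exp_bounded Wx).
rewrite -/f -/g => /le_trans; apply.
have -> : (A * `|b0 - b|)%:C = (2 + strip_bound%:C + strip_bound%:C) *
   (strip_bound%:C * (((4 * pi * `|b0 - b|)%:C + (4 * pi * `|b0 - b|)%:C) / 2)).
  have half (w : C) : (w + w) / 2 = w by rewrite -mulr2n -[w *+ 2]mulr_natr mulfK ?pnatr_eq0.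
  have two : 2 = (2 : R)%:C by rewrite rmorph_nat.
  rewrite half two -!rmorphD -!rmorphM /=; congr (_%:C).
  by rewrite /A; ring.
rewrite ler_wpM2l//.
  by rewrite !addr_ge0// lecR ltW.
rewrite ler_wpM2l//.
  by rewrite lecR ltW.
rewrite ler_wpM2r ?invr_ge0//.
apply: lerD; first exact: le1.
rewrite -!rmorphN /=; apply: le_trans (le1 _ _) _.
by rewrite opprK addrC distrC.
Qed.

End analytic_pinched_fields.

(** * The group generated by 1 and the slope *)

Section slope_group.
Variable R : realType.
Implicit Types (x y b : R).
Local Notation slope := (slope R).

Definition slope_group : set R := [set x | exists m n : int, x = m%:~R + n%:~R * slope].

Lemma slope_groupN x : slope_group x -> slope_group (- x).
Proof. by move=> [m [n ->]]; exists (- m), (- n); rewrite !mulrNz; ring. Qed.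

Lemma slope_groupD x y : slope_group x -> slope_group y -> slope_group (x + y).
Proof. by move=> [m [n ->]] [p [q ->]]; exists (m + p), (n + q); rewrite !intrD; ring. Qed.

Lemma slope_groupB x y : slope_group x -> slope_group y -> slope_group (x - y).
Proof. by move=> gx gy; apply: slope_groupD => //; exact: slope_groupN. Qed.

Lemma slope_groupMz x (k : int) : slope_group x -> slope_group (k%:~R * x).
Proof.
by move=> [m [n ->]]; exists (k * m), (k * n); rewrite !intrM; ring.
Qed.

Lemma slope_group_exp (k : nat) : slope_group (slope ^+ k).
Proof.
elim: k => [|k [m [n E]]]; first by exists 1, 0; rewrite expr0 mul0r addr0.
exists n, (m - 2 * n).
by rewrite exprSr E mulrDl -mulrA -expr2 slope_sqr intrB intrM; ring.
Qed.

(** The powers of [slope] are arbitrarily small positive elements. *)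
Lemma slope_group_dense x (e : R) : 0 < e -> exists2 y, slope_group y & `|y - x| < e.
Proof.
move=> e0; have /andP[s0 s1] := slope_itv R.
have [k ke] : exists k, slope ^+ k < e.
  have : slope ^+ k @[k --> \oo] --> (0 : R).
    by apply: cvg_expr; rewrite gtr0_norm.
  move=> /cvgrPdist_lt/(_ _ e0)[k _ /(_ k (leqnn k))] /=.
  by rewrite sub0r normrN gtr0_norm ?exprn_gt0// => ?; exists k.
have sk0 : 0 < slope ^+ k by rewrite exprn_gt0.
exists ((Num.floor (x / slope ^+ k))%:~R * slope ^+ k).
  by apply: slope_groupMz; exact: slope_group_exp.
set f := Num.floor _.
have f1 : f%:~R * slope ^+ k <= x by rewrite -ler_pdivlMr// floor_le_tmp.
have f2 : x < f%:~R * slope ^+ k + slope ^+ k.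
  have := floorD1_gt (x / slope ^+ k); rewrite -/f intrD1 ltr_pdivrMr//; lra.
by rewrite ltr_norml; lra.
Qed.

Lemma slope_group_countable : countable slope_group.
Proof.
have -> : slope_group = (fun p : int * int => p.1%:~R + p.2%:~R * slope) @` setT.
  apply/seteqP; split=> [x [m [n ->]]|x [[m n] _ <-]]; last by exists m, n.
  by exists (m, n).
by apply: sub_countable (card_image_le _ _) _; exact: countableP.
Qed.

Lemma coset_countable b : countable [set x | slope_group (x - b)].
Proof.
have -> : [set x | slope_group (x - b)] = (fun x => x + b) @` slope_group.
  apply/seteqP; split=> [x /= xb|_ [x xg <-]] /=; last by rewrite addrK.
  by exists (x - b) => //; rewrite subrK.
exact: sub_countable (card_image_le _ _) slope_group_countable.
Qed.

Lemma countable_segment_empty (A : set R) (x y : R) : countable A -> x < y ->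
  exists2 z, x <= z <= y & ~ A z.
Proof.
move=> cA xy; apply: contrapT => noz.
have : countable `[x, y].
  apply: sub_countable cA; apply: subset_card_le => z /=; rewrite in_itv/= => zxy.
  by apply: contrapT => Az; apply: noz; exists z.
move=> /countable_lebesgue_measure0; rewrite lebesgue_measure_itv/= lte_fin xy.
by move=> /eqP; rewrite -EFinB eqe subr_eq0 gt_eqF.
Qed.

(** The intermediate values would fill an interval, which is uncountable. *)
Lemma countable_valued_constant (A : set R) (f : R -> R) : countable A ->
  continuous f -> (forall x, A (f x)) -> forall x y, f x = f y.
Proof.
move=> cA fc fA; suff lt x y : x < y -> f x = f y.
  by move=> x y; case: (ltgtP x y) => [/lt|/lt|->].
move=> xy; apply/eqP; case: (ltgtP (f x) (f y)) => // fxy.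
  have [z zxy] := countable_segment_empty cA fxy.
  have [|t _ <-] := intermediate_value fc (ltW xy) (v := z); first by rewrite zxy.
  by move=> /(_ (fA t)).
have [z zxy] := countable_segment_empty cA fxy.
have [|t _ <-] := intermediate_value fc (ltW xy) (v := z); first by rewrite zxy orbT.
by move=> /(_ (fA t)).
Qed.

End slope_group.

(** * Orbital equivalence determines the second singular point *)

Section rigidity.
Variable R : realType.
Implicit Types (z c p q : R * R) (b : R).
Local Notation dir := (dir R).
Local Notation slope := (slope R).

(** The lines of direction [dir] are the fibres of [leaf]. *)
Definition leaf z : R := z.2 - slope * z.1.

Lemma leafD z p : leaf (z + p) = leaf z + leaf p.
Proof. by rewrite /leaf /=; ring. Qed.

Lemma leaf_line c (r : R) : leaf (c + r *: dir) = leaf c.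
Proof. by rewrite /leaf /= /GRing.scale /=; ring. Qed.

Lemma leaf_int (m n : int) : slope_group (leaf (m%:~R, n%:~R)).
Proof. by exists n, (- m); rewrite /leaf /= mulrNz; ring. Qed.

Lemma leaf_continuous : continuous leaf.
Proof.
move=> z; apply: (@cvgB R R _ (nbhs z) _ snd (fun z => slope * z.1)); first exact: cvg_snd.
by apply: (@cvgM R _ (nbhs z) _ (fun=> slope)); [exact: cvg_cst|exact: cvg_fst].
Qed.

Lemma torus_pi_leaf z z' : torus_pi z = torus_pi z' -> slope_group (leaf z - leaf z').
Proof.
move=> /torus_pi_eqP[m [n E]]; have -> : z = z' + (m%:~R, n%:~R) by rewrite -E subrKC.
by rewrite leafD addrAC subrr add0r; exact: leaf_int.
Qed.

Lemma speed_eq0_leaf b z : speed (0, b) z = 0 ->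
  slope_group (leaf z) \/ slope_group (leaf z - b).
Proof.
rewrite /speed => /eqP; rewrite mulf_eq0 => /orP[] /eqP /pinch_eq0[m [n E]].
  by left; rewrite E; exact: leaf_int.
right; have -> : leaf z - b = leaf (z - (0, b)) by rewrite /leaf /=; ring.
by rewrite E; exact: leaf_int.
Qed.

Lemma regular_leaf_parametrized q c :
  (forall r : R, speed q (c + r *: dir) != 0) ->
  exists phi : R -> R, integral_curve (pinched_field q) (fun t => torus_pi (c + phi t *: dir)) /\
    range phi = setT.
Proof.
move=> reg; pose h r := speed q (c + r *: dir).
have K0 : 0 < 32 * pi :> R by rewrite mulr_gt0// pi_gt0.
have hK := @speed_line_lipschitz R q c.
have hM r := speed_bounds q (c + r *: dir).
have hpos r : 0 < h r by rewrite lt_neqAle eq_sym reg (andP (hM r)).1.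
have [F [dF Fhomo Fonto]] := time_coordinate K0 hK hM (hpos 0).
have [D [CD DK dD]] := solution_exists K0 hK (hpos 0) dF Fhomo Fonto.
exists D; split; first exact: line_integral_curve.
apply/seteqP; split=> // r _; exists (F r) => //; apply: DK => z _; exact: hpos.
Qed.

(** The constant curve at [x] goes to a constant integral curve. Such a curve lifts
    to uniform motion with speed [speed q' c], all of whose positions differ by
    integers: the speed is 0. *)
Lemma singular_point_preserved q q' H x :
  maps_orbits (pinched_field q) (pinched_field q') H ->
  pinched_field q x = 0 -> pinched_field q' (H x) = 0.
Proof.
move=> Hm vx0.
have : integral_curve (pinched_field q) (fun=> x).
  exists (fun=> repr x); first by apply/funext => t /=; rewrite torus_piK.
  by move=> t; rewrite vx0; exact: is_derive_cst.
move=> /Hm[delta [/integral_curve_line[c [phi [dE phi0 dphi]]] [s [_ sonto Hs]]]].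
have Hx t : H x = torus_pi (c + phi t *: dir).
  by have [t' _ <-] : range s t by [rewrite sonto]; rewrite -dE -Hs.
have sc t : speed q' (c + phi t *: dir) = speed q' c.
  apply: (periodic_eq (speed_periodic q')); rewrite -Hx (Hx 0) phi0.
  by rewrite scale0r addr0.
have phiE t : phi t = t * speed q' c.
  apply/eqP; rewrite -subr_eq0; apply/eqP.
  have -> : phi t - t * speed q' c = phi 0 - 0 * speed q' c.
    apply: (@is_derive_0_is_cst R (fun t => phi t - t * speed q' c)) => u.
    have du : is_derive u 1 phi (speed q' c) by rewrite -(sc u); exact: dphi.
    by apply: is_derive_eq; rewrite /GRing.scale /= mulr0 mulr1 add0r subrr.
  by rewrite phi0 mul0r subrr.
rewrite (Hx 0) phi0 scale0r addr0 pinched_fieldE.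
(* Otherwise the curve travels the horizontal length [1 / 2] in time
   [1 / 2 / speed q' c], and [1 / 2] would be an integer. *)
have [->|s0] := eqVneq (speed q' c) 0; first by rewrite scale0r.
have := Hx (1 / 2 / speed q' c); rewrite (Hx 0) phi0 phiE divfK// => /esym/torus_pi_eqP[m [n]].
rewrite scale0r addr0 addrAC subrr add0r => -[/= + _].
rewrite /GRing.scale /= mulr1 => E.
have : (2 * m)%:~R = 1%:~R :> R by rewrite intrM -E; lra.
move=> /eqP; rewrite eqr_int => /eqP /(congr1 absz) /= E2.
by have := congr1 odd E2; rewrite abszM oddM.
Qed.

(** Every line of direction [dir] is dense in the torus. *)
Lemma dense_leaf_constant (E : R * R -> R) c k : continuous E -> torus_periodic E ->
  (forall r : R, E (c + r *: dir) = k) -> forall z, E z = k.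
Proof.
move=> Ec Ep Ek z; apply: contrapT => /eqP; rewrite -subr_eq0 -normr_gt0 => e0.
have /cvgrPdist_lt/(_ _ e0) := Ec z.
move=> /nbhs_ballP[d /= d0 dE].
have [_ [n [m ->]] nd] := slope_group_dense (leaf z - leaf c) d0.
pose r := z.1 - c.1 + m%:~R.
pose w := c + r *: dir + ((- m)%:~R, n%:~R).
have Ew : E w = k by rewrite Ep Ek.
have : `|E z - E w| < `|E z - k|.
  apply: dE; rewrite -ball_normE /= prod_norm_lt; apply/andP; split.
    by rewrite /w /r /= /GRing.scale /= mulr1 mulrNz addrA subrKC addrK subrr normr0.
  move: nd; rewrite distrC; congr (`|_| < _).
  by rewrite /leaf /w /r /= /GRing.scale /=; ring.
by rewrite Ew ltxx.
Qed.

(** On a line that avoids the singular points, [H] maps an orbit to an orbit, whose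
    lift has constant [leaf]; so the transverse part of the displacement takes its
    values in a coset of the countable group [slope_group], and is constant by
    continuity. Density of the line extends this to the whole torus. Such a line
    exists because only countably many values of [leaf] are excluded. *)
Lemma leaf_displacement_constant b b' H D :
  maps_orbits (pinched_field (0, b)) (pinched_field (0, b')) H ->
  displacement H D -> exists k, forall z, leaf (D z) = k.
Proof.
move=> Hm [Dc Dp HD].
pose bad : set R := \bigcup_(i : bool) [set x | slope_group (x - (if i then b else 0))].
have cbad : countable bad by apply: bigcup_countable => // i _; exact: coset_countable.
have [y _ ybad] := countable_segment_empty cbad (@ltr01 R).
pose c : R * R := (0, y).
have reg (r : R) : speed (0, b) (c + r *: dir) != 0.
  apply/eqP => /speed_eq0_leaf; rewrite leaf_line.
  rewrite /leaf /= mulr0 subr0 => yg; apply: ybad.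
  by case: yg => yg; [exists false|exists true]; rewrite //= subr0.
have [phi [/Hm[delta [dcurve [s [_ _ Hs]]]] phionto]] := regular_leaf_parametrized reg.
have [p [psi [dE _ _]]] := integral_curve_line dcurve.
pose E z := leaf (D z).
have Ec : continuous E.
  by move=> z; have lc := @leaf_continuous (D z); exact: (cvg_comp _ _ (Dc z) lc).
have Ep : torus_periodic E by move=> z m n; rewrite /E Dp.
exists (E c); apply: (dense_leaf_constant Ec Ep) => r.
have -> : E c = E (c + 0 *: dir) by rewrite scale0r addr0.
apply: (@countable_valued_constant R _ (fun r => E (c + r *: dir)) (coset_countable (leaf p - leaf c))).
  move=> r'; have lc := @line_continuous R c r'.
  by have EE := Ec (c + r' *: dir); exact: (cvg_comp _ _ lc EE).
move=> r' /=; have [t _ <-] : range phi r' by rewrite phionto.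
have := Hs t; rewrite HD dE => /torus_pi_leaf.
rewrite leafD !leaf_line /E; congr slope_group; ring.
Qed.

(** The transverse displacement being a constant [k], the singular points give
    [k] and [b + k] in the union of [slope_group] and [b' + slope_group]. Of the four
    cases two contradict [b] not in [slope_group]. *)
Lemma rigidity b b' : ~ slope_group b ->
  orbitally_equivalent (pinched_field (0, b)) (pinched_field (0, b')) ->
  slope_group (b' - b) \/ slope_group (b' + b).
Proof.
move=> nb [H [_ Hh Hm]].
have [D DH] := homotopic_displacement Hh.
have [k Dk] := leaf_displacement_constant Hm DH.
have sing z : speed (0, b) z = 0 ->
    slope_group (leaf z + k) \/ slope_group (leaf z + k - b').
  move=> z0; rewrite -(Dk z) -leafD; apply: speed_eq0_leaf.
  have := @singular_point_preserved _ _ H (torus_pi z) Hm.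
  rewrite pinched_fieldE z0 scale0r => /(_ erefl).
  have [_ _ ->] := DH; rewrite pinched_fieldE => /eqP.
  by rewrite scaler_eq0 => /orP[/eqP//|/eqP[/eqP]]; rewrite oner_eq0.
have s0 : speed (0, b) 0 = 0.
  by rewrite /speed (pinch_eq0 0).2 ?mul0r//; exists 0, 0.
have sb : speed (0, b) (0, b) = 0.
  by rewrite /speed subrr (pinch_eq0 0).2 ?mulr0//; exists 0, 0.
have lb : leaf (0, b) = b by rewrite /leaf /= mulr0 subr0.
have l0 : leaf 0 = 0 by rewrite /leaf /= mulr0 subr0.
have := sing _ s0; have := sing _ sb; rewrite lb l0 add0r.
move=> [g1|g1] [g2|g2].
- by case: nb; have := slope_groupB g1 g2; rewrite addrK.
- right; have := slope_groupB g1 g2; congr slope_group; ring.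
- left; have := slope_groupB g2 g1; congr slope_group; ring.
- by case: nb; have := slope_groupB g1 g2; congr slope_group; ring.
Qed.

End rigidity.

(** * Baire category on the line *)

Section baire_category.
Variable R : realType.
Implicit Types (A B U : set R).

Definition comeager A :=
  exists U : nat -> set R, (forall n, open (U n) /\ dense (U n)) /\ \bigcap_n U n `<=` A.

Lemma comeagerS A B : A `<=` B -> comeager A -> comeager B.
Proof. by move=> AB [U [Uod UA]]; exists U; split=> //; exact: subset_trans UA AB. Qed.

Lemma comeager_nonempty A : comeager A -> A !=set0.
Proof.
move=> [U [Uod UA]]; have dU := @Baire R R U Uod.
have [|x [_ Ux]] := dU setT _ openT; first by exists 0.
by exists x; exact: UA.
Qed.

Lemma comeager_open_dense A : open A -> dense A -> comeager A.
Proof. by move=> oA dA; exists (fun=> A); split=> // x /(_ 0%N I). Qed.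

Lemma comeager_bigcap (J : countType) (A : J -> set R) :
  (forall i, comeager (A i)) -> comeager (\bigcap_i A i).
Proof.
move=> /choice[U UP].
exists (fun k => if unpickle k is Some (i, n) then U i n else setT); split.
  move=> k; case: (unpickle k) => [[i n]|]; first exact: (UP i).1.
  by split; [exact: openT|move=> O [x Ox] _; exists x].
move=> x Ux i _; apply: (UP i).2 => n _.
by have := Ux (pickle (i, n)) I; rewrite pickleK.
Qed.

Lemma comeagerI A B : comeager A -> comeager B -> comeager (A `&` B).
Proof.
move=> cA cB; have := @comeager_bigcap bool (fun i => if i then A else B).
move=> /(_ _)/comeagerS; apply; last by case.
by move=> x ABx; split; [exact: (ABx true)|exact: (ABx false)].
Qed.

Lemma countable_enumeration (T : Type) (D : set T) : countable D -> T ->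
  exists f : nat -> T, forall x, D x -> exists n, f n = x.
Proof.
move=> /countable_injP[f finj] x0.
have /choice[g gP] n : exists y, forall x, D x -> f x = n -> y = x.
  have [[x [Dx fx]]|nox] := pselect (exists x, D x /\ f x = n).
    by exists x => y Dy fy; apply: finj; rewrite ?inE// fx fy.
  by exists x0 => y Dy fy; case: nox; exists y.
by exists g => x Dx; exists (f x); exact: gP.
Qed.

Lemma comeager_cocountable A : countable A -> comeager (~` A).
Proof.
move=> /countable_enumeration/(_ 0)[f fA].
have : comeager (\bigcap_n ~` [set f n]).
  apply: comeager_bigcap => n; apply: comeager_open_dense.
    by apply: closed_openC; exact: accessible_closed_set1 (hausdorff_accessible (@Rhausdorff R)) _.
  move=> O [x Ox] oO.
  have : nbhs x O by exact: open_nbhs_nbhs.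
  move=> /nbhs_ballP[e /= e0 eO].
  have [xf|xf] := eqVneq x (f n); last by exists x; split=> //; exact/eqP.
  exists (x + e / 2); split.
    apply: eO; rewrite -ball_normE /= opprD addNKr normrN gtr0_norm; lra.
  by move=> /= E; rewrite -xf in E; lra.
apply: comeagerS => x fx Ax; have [n fn] := fA _ Ax.
by apply: (fx n).
Qed.

Lemma comeager_translate A (c : R) : comeager A -> comeager [set x | A (x - c)].
Proof.
move=> [U [Uod UA]]; exists (fun n => [set x | U n (x - c)]); split; last first.
  by move=> x Ux; apply: UA => n _; exact: Ux.
have tc (b : R) : continuous (fun x : R => x - b).
  by move=> x; apply: cvgB; [exact: cvg_id|exact: cvg_cst].
have top (V : set R) (b : R) : open V -> open [set x | V (x - b)].
  by move=> oV; apply: (open_comp (f := fun x : R => x - b)) => // x _; exact: tc.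
move=> n; have [oU dU] := Uod n; split; first exact: top.
move=> O [x Ox] oO.
have [||y [/= Oy Uy]] := dU [set x | O (x - - c)].
- by exists (x - c); rewrite /= opprK subrK.
- exact: top.
by exists (y + c); split=> /=; [rewrite -(opprK c)|rewrite addrK].
Qed.

Definition baire_property A :=
  exists2 U, open U & comeager [set x | A x <-> U x].

Lemma baire_property_open A : open A -> baire_property A.
Proof.
move=> oA; exists A => //; apply: comeagerS (comeager_open_dense openT _) => //.
by move=> O [x Ox] _; exists x.
Qed.

Lemma baire_property_eq A B :
  comeager [set x | A x <-> B x] -> baire_property A -> baire_property B.
Proof.
move=> AB [U oU AU]; exists U => //; apply: comeagerS (comeagerI AB AU).
by move=> x /= [-> ].
Qed.

(** The boundary of an open set is nowhere dense. *)
Lemma baire_propertyC A : baire_property A -> baire_property (~` A).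
Proof.
move=> [U oU AU]; exists (~` U)°; first exact: open_interior.
have c : comeager (U `|` (~` U)°).
  apply: comeager_open_dense; first by apply: openU => //; exact: open_interior.
  move=> O O0 oO; have [[x [Ox Ux]]|noU] := pselect (O `&` U !=set0).
    by exists x; split=> //; left.
  case: O0 => x Ox; exists x; split=> //; right.
  apply: (filterS _ (open_nbhs_nbhs (conj oO Ox))) => y Oy Uy.
  by apply: noU; exists y.
apply: comeagerS (comeagerI AU c) => x /= [AUx Ux].
split=> [nA|/interior_subset nU /AUx //].
by case: Ux => // Ux; case: nA; apply/AUx.
Qed.

Lemma baire_property_bigcup (A : nat -> set R) :
  (forall n, baire_property (A n)) -> baire_property (\bigcup_n A n).
Proof.
move=> AP; have /choice[U UP] n : exists U, open U /\ comeager [set x | A n x <-> U x].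
  by have [U oU AU] := AP n; exists U.
exists (\bigcup_n U n); first by apply: bigcup_open => n _; exact: (UP n).1.
have := @comeager_bigcap nat _ (fun n => (UP n).2).
apply: comeagerS => x AU; split=> -[n _ An]; exists n => //; exact/(AU n I).
Qed.

(** The sets whose preimage has the Baire property form a sigma-algebra. *)
Lemma baire_property_borel (T : topologicalType) (f : R -> T) :
  (forall V : set T, open V -> open (f @^-1` V)) ->
  forall V : set T, borel_set V -> baire_property (f @^-1` V).
Proof.
move=> fo V /(_ [set V | baire_property (f @^-1` V)]); apply; split; last first.
  by move=> U oU; apply: baire_property_open; exact: fo.
split.
- by rewrite /= preimage_set0; apply: baire_property_open; exact: open0.
- move=> B /= BP; rewrite setTD preimage_setC; exact: baire_propertyC.
- by move=> F FP; rewrite /= preimage_bigcup; exact: baire_property_bigcup.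
Qed.

(** If [A] is comeager in a nonempty open set [U], it is comeager in all translates
    of [U] by [slope_group], which cover the line by density. *)
Lemma zero_one_law A : baire_property A ->
  (forall x y, slope_group y -> A x -> A (x + y)) ->
  comeager A \/ comeager (~` A).
Proof.
move=> [U oU AU] Ainv.
have [[u Uu]|U0] := pselect (U !=set0); last first.
  by right; apply: comeagerS AU => x /= AUx /AUx Ux; apply: U0; exists x.
left; pose t (p : int * int) : R := p.1%:~R + p.2%:~R * slope R.
have := @comeager_bigcap _ _ (fun p : int * int => comeager_translate (t p) AU).
apply: comeagerS => x AUx.
have /nbhs_ballP[e /= e0 eU] : nbhs u U by exact: open_nbhs_nbhs.
have [_ [m [n ->]] gx] := slope_group_dense (x - u) e0.
rewrite -(subrK (t (m, n)) x); apply: Ainv; first by exists m, n.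
apply/(AUx (m, n) I); apply: eU; rewrite -ball_normE /=.
by move: gx; congr (`|_| < _); rewrite /t /=; ring.
Qed.

End baire_category.

(** * Absence of a Borel invariant *)

Section no_invariant.
Variable R : realType.

(** Balls of radius [1 / (n + 1)] around the points of a countable dense set. *)
Lemma polish_separating (Y : topologicalType) (d : Y -> Y -> R) (D : set Y) :
  is_metric d -> metrizes d -> countable D -> dense D -> Y ->
  exists V : nat * nat -> set Y, (forall k, open (V k)) /\
    forall x y, (forall k, V k x <-> V k y) -> x = y.
Proof.
move=> [d0 dsym dtri] dmet cD dD y0.
have [f fD] := countable_enumeration cD y0.
have dpos x y : 0 <= d x y.
  by have := dtri x y x; rewrite (d0 x x).2// (dsym y x); lra.
have ballo y (e : R) : open [set x | d y x < e].
  apply/dmet => x /= yx; exists (e - d y x); first by rewrite subr_gt0.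
  by move=> z /= xz; have := dtri y x z; lra.
exists (fun k => [set x | d (f k.1) x < k.2.+1%:R^-1]); split=> [k|x y sep]; first exact: ballo.
apply/d0/eqP; rewrite eq_le dpos andbT leNgt; apply/negP => dxy.
have [n nd] : exists n : nat, n.+1%:R^-1 < d x y / 2.
  have : 0 < d x y / 2 by rewrite divr_gt0.
  move=> dxy2; have [N _ /(_ N (leqnn N))] := near_infty_natSinv_lt (PosNum dxy2).
  by exists N.
have [|z [/= xz Dz]] := dD [set z | d x z < n.+1%:R^-1] _ (ballo _ _).
  by exists x; rewrite /= (d0 x x).2// invr_gt0 ltr0Sn.
have [i fi] := fD _ Dz.
have zy : d z y < n.+1%:R^-1.
  by rewrite -fi; apply/(sep (i, n)); rewrite /= fi dsym.
by move: nd xz zy (dtri x z y); move: (n.+1%:R^-1) => e; lra.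
Qed.

(** Moving the second singular point by an element of [slope_group] transversally
    amounts, modulo integers, to moving it along its line. The move is a succession of
    small slides: along the line, the value of [g] is locally constant. *)
Lemma pinched_leaf_invariant (Y : topologicalType) (g : analytic_field R -> Y) :
  (forall v w : analytic_field R, orbitally_equivalent v w -> g v = g w) ->
  forall b l : R, ~ slope_group b -> slope_group l ->
  g (pinched (b + l)) = g (pinched b).
Proof.
move=> gE b l nb [m [n ->]].
pose G q := g (AnalyticField (pinched_field_analytic q)).
have Gline q : ~ slope_group (leaf q) -> forall r s : R, G (q + r *: dir R) = G (q + s *: dir R).
  move=> nq; apply: locally_constant => r.
  have pq : pinch (q + r *: dir R) != 0.
    apply/eqP => /pinch_eq0[i [j E]]; apply: nq.
    by rewrite -(leaf_line q r) E; exact: leaf_int.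
  have := slide_orbitally_equivalent pq.
  move=> /nbhs_ballP[e /= e0 eE]; apply/nbhs_ballP; exists e => // s.
  rewrite -ball_normE /= => rs.
  have -> : q + s *: dir R = q + r *: dir R + (s - r) *: dir R.
    by rewrite -addrA -scalerDl subrKC.
  by apply/esym/gE/eE; rewrite -ball_normE /= sub0r normrN distrC.
have Gint q (i j : int) : G (q + (i%:~R, j%:~R)) = G q.
  have fE : pinched_field (q + (i%:~R, j%:~R)) = pinched_field q.
    apply/funext => x; rewrite /pinched_field /speed; congr (_ * _ *: _).
    rewrite -[RHS](pinch_periodic _ (- i) (- j)); congr pinch.
    by apply: injective_projections; rewrite /= mulrNz; ring.
  rewrite /G; move: (pinched_field_analytic _) (pinched_field_analytic _).
  by rewrite fE => va va'; rewrite (Prop_irrelevance va va').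
have lb : leaf (0, b) = b by rewrite /leaf /= mulr0 subr0.
have E : (0, b + (m%:~R + n%:~R * slope R)) =
    (0, b) + n%:~R *: dir R + ((- n)%:~R, m%:~R) :> R * R.
  by apply: injective_projections; rewrite /= /GRing.scale /= ?mulrNz; ring.
rewrite -/(G _) -[RHS]/(G _) E Gint (Gline _ _ _ 0) ?lb//.
by rewrite scale0r addr0.
Qed.

End no_invariant.

Theorem theorem3 (R : realType) :
  ~ exists (Y : topologicalType) (g : analytic_field R -> Y),
      [/\ polish R Y, borel_function g &
          forall v w : analytic_field R,
            orbitally_equivalent v w <-> g v = g w].
Proof.
move=> [Y [g [[[D cD dD] [d [dmet dY _]]] gB gE]]].
pose g1 b := g (pinched b).
have [V [oV Vsep]] := polish_separating dmet dY cD dD (g1 0).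
have g1inv b l : ~ slope_group b -> slope_group l -> g1 (b + l) = g1 b.
  by apply: pinched_leaf_invariant => v w /gE.
(* Only outside [slope_group] is the preimage known to be invariant; that group
   is meager. *)
pose A k := ~` @slope_group R `&` g1 @^-1` V k.
have cG := comeager_cocountable (@slope_group_countable R).
have Ak k : comeager (A k) \/ comeager (~` A k).
  apply: zero_one_law => [|x y gy [nx Vx]]; last first.
    split; last by rewrite /preimage /= g1inv.
    by move=> gxy; apply: nx; rewrite -(addrK y x); exact: slope_groupB.
  apply: (@baire_property_eq _ (g1 @^-1` V k)).
    by apply: comeagerS cG => x nx; split=> [Vx|[_]//]; split.
  exact: (baire_property_borel (@pinched_continuous R) (gB _ (oV k))).
(* Each [B k] is comeager, and on its points outside [slope_group] either all values
   of [g1] lie in [V k] or none does: [g1] is constant on their intersection. *)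
pose B k := if pselect (comeager (A k)) then A k else ~` A k.
have cB k : comeager (B k).
  by rewrite /B; case: pselect => // nA; case: (Ak k).
have cS := comeagerI cG (comeager_bigcap cB).
have [b [nb bB]] := comeager_nonempty cS.
have cb (c : R) := comeager_cocountable (coset_countable c).
have [b' [[nb' b'B] [n1 n2]]] :=
  comeager_nonempty (comeagerI cS (comeagerI (cb b) (cb (- b)))).
have gbb : g1 b = g1 b'.
  apply: Vsep => k; have := bB k I; have := b'B k I; rewrite /B.
  case: pselect => [? [_ V1] [_ V2]|? /= A1 A2]; first by split.
  by split=> Vx; [have := A2 (conj nb Vx)|have := A1 (conj nb' Vx)].
have [] := rigidity nb ((gE _ _).2 gbb) => //.
by move=> h; apply: n2; rewrite /= opprK.
Qed.
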